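(* Let $(M,E)$ be a Finsler space with canonical spray $S$, Liouville vector field $C$, Barthel curvature $\mathfrak{R}$, and let $R$ be the h-curvature of its Cartan connection. The nullity distribution $\mathcal{N}_R$ has the following properties: (a) $\mathcal{N}_R\neq\emptyset$. (b) $\mathcal{N}_R\subseteq\mathcal{N}_{\mathfrak{R}}$. (c) If $Z\in\mathcal{N}_R$, then $R(X,Y)Z=\mathcal{C}(F\mathfrak{R}(X,Y),Z)$ for all vector fields $X,Y$ on $TM$. (d) If $S\in\mathcal{N}_R$, then $\mathfrak{R}=0$. (e) If $X\in\mathcal{N}_R$, then $[C,X]\in\mathcal{N}_R$ and consequently $[C,X]\in\mathcal{N}_{\mathfrak{R}}$.
   Context: Setting (Klein–Grifone approach). $M$ is a smooth $n$-dimensional manifold, $\mathcal{T}M\subset TM$ is the bundle of nonzero tangent vectors, and $X,Y,Z$ denote vector fields on $TM$ (objects are smooth on $\mathcal{T}M$). $J$ is the natural almost tangent structure of $TM$ (locally $J\partial_{x^i}=\partial_{y^i}$, $J\partial_{y^i}=0$), $C$ is the Liouville vector field (locally $y^i\partial_{y^i}$), and $V(TM)=\operatorname{Im}J=\ker J$. A Finsler space $(M,E)$ is given by $E:TM\to\mathbb{R}$ with $E>0$ on $\mathcal{T}M$, $E(0)=0$, $E$ of class $C^\infty$ on $\mathcal{T}M$ and $C^1$ on $TM$, $\mathcal{L}_CE=2E$, and $\Omega:=dd_JE$ (where $d_JE=dE\circ J$) of maximal rank. The canonical spray $S$ is defined by $i_S\Omega=-dE$. The Barthel connection is $\Gamma=[J,S]$,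 i.e. $\Gamma X=[JX,S]-J[X,S]$. Put $h=\frac12(I+\Gamma)$, $v=\frac12(I-\Gamma)$, and $H(TM)=\operatorname{Im}h$ (rank $n$). The curvature of the Barthel connection is $\mathfrak{R}=-\frac12[h,h]$ (equivalently $\mathfrak{R}(X,Y)=-v[hX,hY]$). The almost complex structure $F$ is defined by $FJ=h$, $Fh=-J$. The metric $g$ is $g(X,Y)=\Omega(X,FY)$, so that $g(JX,JY)=\Omega(JX,Y)$. The Berwald connection $D^\circ$ is the linear connection on $TM$ with $D^\circ_{JX}JY=J[JX,Y]$, $D^\circ_{hX}JY=v[hX,JY]$, $D^\circ F=0$. The first and second Cartan tensors $\mathcal{C},\mathcal{C}'$ are the symmetric semi-basic (vertical-valued) tensors given by $\Omega(\mathcal{C}(X,Y),Z)=\frac12(\mathcal{L}_{JX}(J^*g))(Y,Z)$ and $\Omega(\mathcal{C}'(X,Y),Z)=\frac12(\mathcal{L}_{hX}g)(JY,JZ)$, where $(J^*g)(Y,Z)=g(JY,JZ)$. The Cartan connection $D$ is the linear connection on $TM$ with $D_{JX}JY=D^\circ_{JX}JY+\mathcal{C}(X,Y)$, $D_{hX}JY=D^\circ_{hX}JY+\mathcal{C}'(X,Y)$, $DF=0$. With $K(A,B)=[D_A,D_B]-D_{[A,B]}$ the curvature of $D$, the h-curvature is $R(X,Y)Z=K(hX,hY)JZ$. Nullity spaces: $\mathcal{N}_R(z)=\{X\in H_z(TM): R(X,Y)=0\ \forall\,Y\in T_z(TM)\}$ and $\mathcal{N}_{\mathfrak{R}}(z)=\{X\in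 H_z(TM): \mathfrak{R}(X,Y)=0\ \forall\,Y\in T_z(TM)\}$. When the dimension is constant, $z\mapsto\mathcal{N}_R(z)$ defines the nullity distribution $\mathcal{N}_R$ (likewise $\mathcal{N}_{\mathfrak{R}}$); ''$X\in\mathcal{N}_R$'' means $X$ is a vector field with values in $\mathcal{N}_R$ (a nullity vector field). *)

(* Defs.v *)
From HB Require Import structures.
From mathcomp Require Import all_boot all_order all_algebra.
From mathcomp Require Import all_classical all_reals all_analysis.

Set Implicit Arguments.
Unset Strict Implicit.
Unset Printing Implicit Defensive.

Import Order.TTheory GRing.Theory Num.Theory numFieldNormedType.Exports.
Local Open Scope classical_set_scope.
Local Open Scope ring_scope.

(* Meant for an open set A of a finite-dimensional U: all iterated directional
   derivatives of order at most k exist and are continuous at the points of A. *)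
Fixpoint Ck_on (R : realType) (U W : normedModType R) (k : nat) (A : set U)
    (f : U -> W) : Prop :=
  (forall z, A z -> {for z, continuous f}) /\
  (if k is k'.+1 then
     forall v : U, (forall z, A z -> derivable f z v) /\
                   Ck_on k' A (fun z => 'D_v f z : W)
   else True).

Definition smooth_on (R : realType) (U W : normedModType R) (A : set U)
    (f : U -> W) : Prop := forall k, Ck_on k A f.

(* A smooth n-manifold given by a (not necessarily maximal) smooth atlas.
   [icoord i] is the inverse chart; it is meaningful on the image of [dom i]. *)
Record manifold (R : realType) (n : nat) := Manifold {
  carrier :> topologicalType;
  carrier_hausdorff : hausdorff_space carrier;
  carrier_second_countable : @second_countable carrier;
  chart : Type;
  dom : chart -> set carrier;
  coord : chart -> carrier -> 'rV[R]_n;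
  icoord : chart -> 'rV[R]_n -> carrier;
  dom_open : forall i, open (dom i);
  dom_cover : forall p, exists i, dom i p;
  image_open : forall i, open (coord i @` dom i);
  coordK : forall i p, dom i p -> icoord i (coord i p) = p;
  coord_cont : forall i p, dom i p -> {for p, continuous (coord i)};
  icoord_cont : forall i x, (coord i @` dom i) x ->
    {for x, continuous (icoord i)};
  transition_smooth : forall i j,
    smooth_on [set x | (coord i @` dom i) x /\ dom j (icoord i x)]
      (coord j \o icoord i)
}.

(* The product 'rV_n * 'rV_n plays two roles: a point (x, y) of TM in the
   coordinates induced by a chart of M, and a tangent vector (a, b) to TM, i.e.
   a d/dx + b d/dy.  [vf] and [sf] are vector fields and functions in one such
   coordinate system, [form1] and [form2] are (field-level) 1-forms and
   covariant 2-tensors, [endo] is a vector-valued 1-form. *)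
Definition TV (R : realType) (n : nat) : normedModType R :=
  ('rV[R]_n * 'rV[R]_n)%type.
Notation vf R n := (TV R n -> TV R n).
Notation sf R n := (TV R n -> R).
Notation form1 R n := (vf R n -> sf R n).
Notation form2 R n := (vf R n -> vf R n -> sf R n).
Notation endo R n := (vf R n -> vf R n).

Section Calculus.
Context {R : realType} {n : nat}.
Implicit Types (X Y Z S : vf R n) (E f : sf R n) (K L : endo R n).

Definition tangentJ (a : TV R n) : TV R n := (0, a.1).
Definition J X : vf R n := fun z => tangentJ (X z).
Definition liouville : vf R n := fun z => (0, z.2).

(* X . f *)
Definition lie0 X f : sf R n := fun z => 'D_(X z) f z.

Definition bracket X Y : vf R n := fun z => 'D_(X z) Y z - 'D_(Y z) X z.

Definition extd (w : form1 R n) : form2 R n := fun X Y z =>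
  lie0 X (w Y) z - lie0 Y (w X) z - w (bracket X Y) z.

Definition lie2 X (B : form2 R n) : form2 R n := fun Y Z z =>
  lie0 X (B Y Z) z - B (bracket X Y) Z z - B Y (bracket X Z) z.

Definition d E : form1 R n := fun X => lie0 X E.
Definition dJ E : form1 R n := fun X => d E (J X).
Definition Omega E : form2 R n := extd (dJ E).

(* Froelicher-Nijenhuis bracket of two vector-valued 1-forms *)
Definition fn_bracket K L X Y : vf R n := fun z =>
  bracket (K X) (L Y) z + bracket (L X) (K Y) z
  + K (L (bracket X Y)) z + L (K (bracket X Y)) z
  - K (bracket (L X) Y) z - K (bracket X (L Y)) z
  - L (bracket (K X) Y) z - L (bracket X (K Y)) z.

(* Gamma = [J, S] *)
Definition barthel S : endo R n := fun X z =>
  bracket (J X) S z - J (bracket X S) z.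
Definition hproj S : endo R n := fun X z => 2%:R^-1 *: (X z + barthel S X z).
Definition vproj S : endo R n := fun X z => 2%:R^-1 *: (X z - barthel S X z).

Definition barthel_curv S X Y : vf R n := fun z =>
  - (2%:R^-1 *: fn_bracket (hproj S) (hproj S) X Y z).

Definition app1 (F : TV R n -> TV R n -> TV R n) X : vf R n :=
  fun z => F z (X z).
Definition app2 (T : TV R n -> TV R n -> TV R n -> TV R n) X Y : vf R n :=
  fun z => T z (X z) (Y z).

Definition metric E F : form2 R n := fun X Y => Omega E X (app1 F Y).
Definition pullJ (B : form2 R n) : form2 R n := fun X Y => B (J X) (J Y).

Definition curvature (D : vf R n -> endo R n) X Y Z : vf R n := fun z =>
  D X (D Y Z) z - D Y (D X Z) z - D (bracket X Y) Z z.

Definition hcurv S (D : vf R n -> endo R n) X Y Z : vf R n :=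
  curvature D (hproj S X) (hproj S Y) (J Z).

(* coordinate frame d/dx^1, .., d/dx^n, d/dy^1, .., d/dy^n *)
Definition frame (k : 'I_(n + n)) : vf R n := fun _ =>
  match fintype.split k with
  | inl a => (delta_mx 0 a, 0)
  | inr b => (0, delta_mx 0 b)
  end.

Definition gram (B : form2 R n) (z : TV R n) : 'M[R]_(n + n) :=
  \matrix_(k, l) B (frame k) (frame l) z.

End Calculus.

(* TM is described by the atlas induced by that of M: chart i of M induces
   coordinates (x, y) in [tdom M i], with transition maps [ttrans M i j] on
   [tover M i j].  [slit M i] is the part of [tdom M i] off the zero section,
   so the [slit M i] form an atlas of the bundle of nonzero vectors.  A global
   object on TM is a family of local ones, indexed by the charts of M and
   compatible with the transition maps. *)
Section TangentBundle.
Context {R : realType} {n : nat} (M : manifold R n).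
Implicit Types (i j : chart M).

Definition tdom i : set (TV R n) := [set z | (coord i @` dom i) z.1].
Definition slit i : set (TV R n) := [set z | tdom i z /\ z.2 != 0].

Definition tover i j : set (TV R n) :=
  [set z | tdom i z /\ dom j (icoord i z.1)].

Definition ttrans i j : TV R n -> TV R n := fun z =>
  let t := coord j \o icoord i in (t z.1, 'D_(z.2) t z.1).

Definition push i j (z a : TV R n) : TV R n := 'D_a (ttrans i j) z.

Definition local_vf i : set (vf R n) := [set X | smooth_on (slit i) X].

Definition related i j (X Y : vf R n) : Prop :=
  forall z, slit i z -> tover i j z -> Y (ttrans i j z) = push i j z (X z).

(* vector fields on the bundle of nonzero vectors *)
Definition vfield : set (chart M -> vf R n) :=
  [set X | (forall i, local_vf i (X i)) /\
           (forall i j, related i j (X i) (X j))].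

Definition tensor11 (F : chart M -> TV R n -> TV R n -> TV R n) : Prop :=
  [/\ forall i z, slit i z -> forall (c : R) (a b : TV R n),
        F i z (c *: a + b) = c *: F i z a + F i z b,
      forall i a, smooth_on (slit i) (fun z => F i z a)
    & forall i j z a, slit i z -> tover i j z ->
        F j (ttrans i j z) (push i j z a) = push i j z (F i z a)].

Definition tensor12 (T : chart M -> TV R n -> TV R n -> TV R n -> TV R n) :
    Prop :=
  [/\ forall i z, slit i z -> forall (c : R) (a a' b : TV R n),
        T i z (c *: a + a') b = c *: T i z a b + T i z a' b /\
        T i z b (c *: a + a') = c *: T i z b a + T i z b a',
      forall i a b, smooth_on (slit i) (fun z => T i z a b)
    & forall i j z a b, slit i z -> tover i j z ->
        T j (ttrans i j z) (push i j z a) (push i j z b)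
        = push i j z (T i z a b)].

Definition symmetric_semibasic
    (T : chart M -> TV R n -> TV R n -> TV R n -> TV R n) : Prop :=
  [/\ tensor12 T,
      forall i z a b, slit i z -> T i z a b = T i z b a,
      forall i z a b, slit i z -> T i z (tangentJ a) b = 0
    & forall i z a b, slit i z -> tangentJ (T i z a b) = 0].

Definition linear_connection (D : chart M -> vf R n -> endo R n) : Prop :=
  [/\ forall i X Y, local_vf i X -> local_vf i Y -> local_vf i (D i X Y),
      forall i X X' Y, local_vf i X -> local_vf i X' -> local_vf i Y ->
        forall f : sf R n, smooth_on (slit i) f -> forall z, slit i z ->
        D i (fun u => f u *: X u + X' u) Y z
        = f z *: D i X Y z + D i X' Y z,
      forall i X Y Y', local_vf i X -> local_vf i Y -> local_vf i Y' ->
        forall f : sf R n, smooth_on (slit i) f -> forall z, slit i z ->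
        D i X (fun u => f u *: Y u + Y' u) z
        = lie0 X f z *: Y z + f z *: D i X Y z + D i X Y' z
    & forall i j X Y X' Y', local_vf i X -> local_vf i Y ->
        local_vf j X' -> local_vf j Y' ->
        related i j X X' -> related i j Y Y' ->
        related i j (D i X Y) (D j X' Y')].

Definition finsler (E : chart M -> sf R n) : Prop :=
  (forall i j z, tover i j z -> E j (ttrans i j z) = E i z) /\
  [/\ forall i z, slit i z -> 0 < E i z,
      forall i z, tdom i z -> z.2 = 0 -> E i z = 0,
      forall i, smooth_on (slit i) (E i) /\ Ck_on 1 (tdom i) (E i),
      forall i z, tdom i z -> lie0 liouville (E i) z = 2%:R * E i z
    & forall i z, slit i z -> \rank (gram (Omega (E i)) z) = (n + n)%N].

(* i_S Omega = - dE *)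
Definition canonical_spray (E : chart M -> sf R n) (S : chart M -> vf R n) :
    Prop :=
  vfield S /\
  forall i X, local_vf i X -> forall z, slit i z ->
    Omega (E i) (S i) X z = - d (E i) X z.

Definition almost_complex (S : chart M -> vf R n)
    (F : chart M -> TV R n -> TV R n -> TV R n) : Prop :=
  tensor11 F /\
  forall i X, local_vf i X -> forall z, slit i z ->
    app1 (F i) (J X) z = hproj (S i) X z /\
    app1 (F i) (hproj (S i) X) z = - J X z.

Definition first_cartan_tensor (E : chart M -> sf R n)
    (F : chart M -> TV R n -> TV R n -> TV R n)
    (C : chart M -> TV R n -> TV R n -> TV R n -> TV R n) : Prop :=
  symmetric_semibasic C /\
  forall i X Y Z, local_vf i X -> local_vf i Y -> local_vf i Z ->
    forall z, slit i z ->
    Omega (E i) (app2 (C i) X Y) Z z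
    = 2%:R^-1 * lie2 (J X) (pullJ (metric (E i) (F i))) Y Z z.

Definition second_cartan_tensor (E : chart M -> sf R n)
    (S : chart M -> vf R n) (F : chart M -> TV R n -> TV R n -> TV R n)
    (C' : chart M -> TV R n -> TV R n -> TV R n -> TV R n) : Prop :=
  symmetric_semibasic C' /\
  forall i X Y Z, local_vf i X -> local_vf i Y -> local_vf i Z ->
    forall z, slit i z ->
    Omega (E i) (app2 (C' i) X Y) Z z
    = 2%:R^-1 * lie2 (hproj (S i) X) (metric (E i) (F i)) (J Y) (J Z) z.

(* D F = 0 *)
Definition parallel (D : chart M -> vf R n -> endo R n)
    (F : chart M -> TV R n -> TV R n -> TV R n) : Prop :=
  forall i X Y, local_vf i X -> local_vf i Y -> forall z, slit i z ->
    D i X (app1 (F i) Y) z = app1 (F i) (D i X Y) z.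

Definition berwald_connection (S : chart M -> vf R n)
    (F : chart M -> TV R n -> TV R n -> TV R n)
    (D : chart M -> vf R n -> endo R n) : Prop :=
  [/\ linear_connection D,
      forall i X Y, local_vf i X -> local_vf i Y -> forall z, slit i z ->
        D i (J X) (J Y) z = J (bracket (J X) Y) z,
      forall i X Y, local_vf i X -> local_vf i Y -> forall z, slit i z ->
        D i (hproj (S i) X) (J Y) z
        = vproj (S i) (bracket (hproj (S i) X) (J Y)) z
    & parallel D F].

Definition cartan_connection (S : chart M -> vf R n)
    (F : chart M -> TV R n -> TV R n -> TV R n)
    (C C' : chart M -> TV R n -> TV R n -> TV R n -> TV R n)
    (D0 D : chart M -> vf R n -> endo R n) : Prop :=
  [/\ linear_connection D,
      forall i X Y, local_vf i X -> local_vf i Y -> forall z, slit i z ->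
        D i (J X) (J Y) z = D0 i (J X) (J Y) z + app2 (C i) X Y z,
      forall i X Y, local_vf i X -> local_vf i Y -> forall z, slit i z ->
        D i (hproj (S i) X) (J Y) z
        = D0 i (hproj (S i) X) (J Y) z + app2 (C' i) X Y z
    & parallel D F].

(* H_z(TM) = Im h *)
Definition hspace (S : chart M -> vf R n) i (z : TV R n) : set (TV R n) :=
  [set a | exists2 X, local_vf i X & hproj (S i) X z = a].

(* The tensors R and R-frak act here on vector fields, so their value at a
   tangent vector a is taken on the local fields X with X(z) = a. *)
Definition nullity_R (S : chart M -> vf R n)
    (D : chart M -> vf R n -> endo R n) i (z : TV R n) : set (TV R n) :=
  [set a | hspace S i z a /\
     forall X Y Z, local_vf i X -> local_vf i Y -> local_vf i Z ->
       X z = a -> hcurv (S i) (D i) X Y Z z = 0].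

Definition nullity_barthel (S : chart M -> vf R n) i (z : TV R n) :
    set (TV R n) :=
  [set a | hspace S i z a /\
     forall X Y, local_vf i X -> local_vf i Y ->
       X z = a -> barthel_curv (S i) X Y z = 0].

Definition sections (N : chart M -> TV R n -> set (TV R n)) :
    set (chart M -> vf R n) :=
  [set X | vfield X /\ forall i z, slit i z -> N i z (X i z)].

End TangentBundle.

(* Main.v *)
Require Import Defs.
From HB Require Import structures.
From mathcomp Require Import all_boot all_order all_algebra.
From mathcomp Require Import all_classical all_reals all_analysis.
From mathcomp Require Import ring lra.

(** Why the theorem holds.

   Fix a chart (x, y) and write the spray as S = (y, s(x, y)). The spray
   equation becomes the geodesic equation S(dE/dy^b) = dE/dx^b ([spray_hess]);
   with Euler's identity for E and nondegeneracy of the vertical Hessian it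
   shows that s is quadratic in y ([homog_S2]) and that E is constant along
   horizontal lifts ([energy_hlift]). The metric of two vertical vectors is
   their Hessian pairing, so both Cartan tensors have explicit expressions in
   E and s. They vanish when one argument is S, the second one because its
   expression becomes a vertical derivative of d_h E = 0
   ([first_cartan_liouville], [second_cartan_liouville]).

   Hence the Liouville field C = JS satisfies D_V C = v V for every V
   ([conn_spray]): it is parallel along horizontal fields, and
   R(X, Y)S = K(hX, hY)C = - v [hX, hY] is the Barthel curvature
   ([hcurv_spray], [barthel_curvE]). So a vector that kills R kills the Barthel
   curvature, which is (b).

   For (c), the curvature is tensorial ([curvature_pointwise]), so it can be
   computed on horizontal lifts of constant vectors and constant vertical
   fields. There the horizontal covariant derivative has symmetric
   coefficients, whence the Bianchi identity: the cyclic sum of R(X, Y)Z is the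
   cyclic sum of C(F R-frak(X, Y), Z), with C the first Cartan tensor
   ([hcurv0_bianchi]). If Z is a nullity vector, only the terms with R(X, Y)Z
   and R-frak(X, Y) survive ([hcurv_null]). Taking Z = S, the left side is
   R-frak(X, Y) and the right side vanishes, which is (d).

   For (e), the components of R are homogeneous of degree 0 in y
   ([homog_hcurv0]), so differentiating R(X, b)c = 0 along C, for constant b
   and c, leaves R([C, X], b)c = 0 ([null_bracket_liouville]). That [C, X] is a
   vector field on the whole bundle is the naturality of the Lie bracket under
   changes of charts ([related_bracket]). The zero field gives (a).

   Smoothness is given by iterated directional derivatives, so the calculus
   starts from there: derivatives are linear in the direction, mixed
   derivatives are symmetric and the chain rule holds, all by the mean value
   theorem along lines. *)

Set Implicit Arguments.
Unset Strict Implicit.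
Unset Printing Implicit Defensive.

Import Order.TTheory GRing.Theory Num.Theory numFieldNormedType.Exports.
Local Open Scope classical_set_scope.
Local Open Scope ring_scope.

(** * Calculus of directional derivatives *)

Section Linf.
Context {R : realType} {U W : normedModType R}.

Definition is_linear (L : U -> W) := forall (c : R) a b, L (c *: a + b) = c *: L a + L b.

Variable L : U -> W.
Hypothesis lL : is_linear L.

Lemma linf0 : L 0 = 0.
Proof.
have := lL 1 0 0; rewrite !scale1r addr0 => /esym/eqP.
by rewrite -subr_eq0 addrK => /eqP.
Qed.

Lemma linfZ c a : L (c *: a) = c *: L a.
Proof. by have := lL c a 0; rewrite linf0 !addr0. Qed.

Lemma linfD a b : L (a + b) = L a + L b.
Proof. by have := lL 1 a b; rewrite !scale1r. Qed.

Lemma linfN a : L (- a) = - L a.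
Proof. by rewrite -scaleN1r linfZ scaleN1r. Qed.

Lemma linfB a b : L (a - b) = L a - L b.
Proof. by rewrite linfD linfN. Qed.

Lemma linf_sum (I : finType) (g : I -> U) : L (\sum_i g i) = \sum_i L (g i).
Proof. exact: (big_morph L linfD linf0). Qed.

End Linf.

Lemma linf_sub (R : realType) (U W : normedModType R) (f g : U -> W) :
  is_linear f -> is_linear g -> is_linear (fun a => f a - g a).
Proof. by move=> lf lg c a b; rewrite lf lg scalerBr opprD addrACA. Qed.

Lemma linf_comp (R : realType) (U V W : normedModType R) (f : V -> W) (g : U -> V) :
  is_linear f -> is_linear g -> is_linear (fun a => f (g a)).
Proof. by move=> lf lg c a b; rewrite lg lf. Qed.

Section Lines.
Context {R : realType} {U W : normedModType R}.

Lemma is_derive_line (f : U -> W) (z v : U) (t : R) :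
  derivable f (z + t *: v) v ->
  is_derive t (1 : R) (fun s : R => f (z + s *: v)) ('D_v f (z + t *: v)).
Proof.
have E : (fun h : R => h^-1 *: (((fun s : R => f (z + s *: v)) \o shift t) (h *: (1:R))
    - f (z + t *: v))) = (fun h => h^-1 *: ((f \o shift (z + t *: v)) (h *: v) - f (z + t *: v))).
  apply: funext => h /=; congr (_ *: (f _ - _)).
  by rewrite [h *: (1 : R)]mulr1 scalerDl addrCA.
move=> df; apply: DeriveDef; first by rewrite /derivable E.
by rewrite /derive E.
Qed.

Lemma is_deriveZv (f : U -> W) (z v : U) (c : R) :
  derivable f z v -> is_derive z (c *: v) f (c *: 'D_v f z).
Proof.
have [->|c0 df] := eqVneq c 0.
  by rewrite !scale0r => _; exact: is_derive0.
suff H : (fun h => h^-1 *: ((f \o shift z) (h *: (c *: v)) - f z)) @ 0^' --> c *: 'D_v f z.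
  by apply: DeriveDef; [exact: (cvgP (c *: 'D_v f z)) | exact/cvg_lim].
have E : (fun h => h^-1 *: ((f \o shift z) (h *: (c *: v)) - f z)) =
   (fun h => c *: ((fun k => k^-1 *: ((f \o shift z) (k *: v) - f z)) (h * c))).
  by apply: funext => h /=; rewrite !scalerA invfM mulrCA mulfV// mulr1.
rewrite E; apply: cvgZl_tmp; apply: (cvg_comp _ _ _ df) => B [e /= e0 He].
have ce0 : 0 < e / `|c| by rewrite divr_gt0// normr_gt0.
exists (e / `|c|) => //= h; rewrite /ball_/= sub0r normrN => he h0.
apply: He; rewrite ?mulf_neq0//= /ball_/= sub0r normrN normrM.
by rewrite -ltr_pdivlMr// normr_gt0.
Qed.

Lemma is_derive_lin_comp (W' : normedModType R) (L : W -> W') (f : U -> W)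
    (z v : U) :
  is_linear L -> continuous L ->
  derivable f z v -> is_derive z v (L \o f) (L ('D_v f z)).
Proof.
move=> lL cL df.
have E : (fun h => h^-1 *: (((L \o f) \o shift z) (h *: v) - (L \o f) z)) =
   L \o (fun h => h^-1 *: ((f \o shift z) (h *: v) - f z)).
  by apply: funext => h /=; rewrite (linfZ lL) (linfB lL).
have H : (fun h => h^-1 *: (((L \o f) \o shift z) (h *: v) - (L \o f) z)) @ 0^'
   --> L ('D_v f z).
  by rewrite E; apply: continuous_cvg => //; exact: cL.
by apply: DeriveDef; [exact: (cvgP (L ('D_v f z))) | exact/cvg_lim].
Qed.

End Lines.

Lemma MVT_line (R : realType) (U : normedModType R) (f : U -> R) (z v : U)
    (A : set U) :
  (forall t : R, 0 <= t <= 1 -> A (z + t *: v)) ->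
  (forall u, A u -> derivable f u v) ->
  exists2 t : R, 0 <= t <= 1 & f (z + v) - f z = 'D_v f (z + t *: v).
Proof.
move=> zA df.
have [|||t] := @MVT R (fun s => f (z + s *: v)) (fun s => 'D_v f (z + s *: v)) 0 1.
- exact: ltr01.
- move=> x; rewrite in_itv/= => /andP[/ltW x0 /ltW x1]; apply: is_derive_line.
  by apply/df/zA; rewrite x0.
- apply: derivable_within_continuous => x; rewrite in_itv/= => x01.
  have dfx := df _ (zA _ x01).
  by have [] := is_derive_line dfx.
rewrite in_itv/= => /andP[/ltW t0 /ltW t1]; exists t; first by rewrite t0.
by move: q; rewrite scale1r scale0r addr0 subr0 mulr1.
Qed.

Lemma cvg_sumf (R : realType) (W : normedModType R) (T : Type) (F : set_system T)
    (I : finType) (f : I -> T -> W) (a : I -> W) : Filter F ->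
  (forall i, f i x @[x --> F] --> a i) ->
  (\sum_i f i x) @[x --> F] --> \sum_i a i.
Proof.
move=> FF fa; elim: (index_enum I) => [|i s IHs].
  by rewrite big_nil; under eq_fun do rewrite big_nil; exact: cvg_cst.
by rewrite big_cons; under eq_fun do rewrite big_cons; exact: cvgD.
Qed.

Lemma is_derive_sumf (R : realType) (U W : normedModType R) (I : finType)
    (f : I -> U -> W) (df : I -> W) (z v : U) :
  (forall i, is_derive z v (f i) (df i)) ->
  is_derive z v (fun y => \sum_i f i y) (\sum_i df i).
Proof.
move=> dfE; elim: (index_enum I) => [|i s IHs].
  by rewrite big_nil; under eq_fun do rewrite big_nil; exact: is_derive_cst.
rewrite big_cons; under eq_fun do rewrite big_cons.
exact: (@is_deriveD _ _ _ (f i) (fun y => \sum_(j <- s) f j y)).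
Qed.

Section Additivity.
Context {R : realType} {U : normedModType R}.

(** The increment along h (u + v) splits into one along h u, governed by the
    derivative at z, and one along h v, governed by the mean value theorem and
    the continuity of the derivative along v. *)
Lemma is_deriveDv_real (f : U -> R) (A : set U) (z u v : U) :
  open A -> A z -> derivable f z u -> (forall y, A y -> derivable f y v) ->
  {for z, continuous (fun y => 'D_v f y : R)} ->
  is_derive z (u + v) f ('D_u f z + 'D_v f z).
Proof.
move=> oA Az dfu dfv cfv.
suff H : (fun h => h^-1 *: ((f \o shift z) (h *: (u + v)) - f z)) @ 0^' --> 'D_u f z + 'D_v f z.
  by apply: DeriveDef; [exact: (cvgP ('D_u f z + 'D_v f z)) | exact/cvg_lim].
have E : (fun h => h^-1 *: ((f \o shift z) (h *: (u + v)) - f z)) =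
  (fun h => h^-1 *: ((f \o shift z) (h *: u) - f z)) \+
  (fun h => h^-1 *: (f (h *: u + z + h *: v) - f (h *: u + z))).
  apply: funext => h /=; rewrite -scalerDr; congr (_ *: _).
  by rewrite [RHS]addrC addrA subrK scalerDr addrAC.
rewrite E; apply: cvgD; first exact: dfu.
apply/cvgrPdist_le => /= e e0.
have /nbhs_ballP[r /= r0 Hr] : \forall y \near z, A y /\ `|'D_v f z - 'D_v f y| <= e.
  near=> y; split; near: y; first exact: open_nbhs_nbhs.
  by move/cvgrPdist_le : cfv => /(_ e e0).
pose k := `|u| + `|v| + 1.
have k0 : 0 < k by rewrite ltr_wpDl// addr_ge0.
exists (r / k); first by rewrite /= divr_gt0.
move=> h; rewrite /ball_/= sub0r normrN => hr h0.
have near_z (t : R) : 0 <= t <= 1 -> ball z r (h *: u + z + t *: (h *: v)).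
  move=> /andP[t0 t1]; rewrite -ball_normE /ball_/= -addrA addrCA opprD addrA subrr sub0r normrN.
  rewrite (le_lt_trans (ler_normD _ _))// !normrZ mulrCA -mulrDr.
  apply: (@le_lt_trans _ _ (`|h| * k)); last by rewrite -ltr_pdivlMr.
  rewrite ler_wpM2l// /k -addrA lerD// ler_wpDr// ger0_norm// ler_piMl//.
have dfh y : ball z r y -> derivable f y (h *: v).
  by move=> /Hr[Ay _]; have [] := is_deriveZv h (dfv _ Ay).
have [t t01 ->] := MVT_line near_z dfh.
have [Ay dle] := Hr _ (near_z _ t01).
have [_ ->] := is_deriveZv h (dfv _ Ay).
by rewrite scalerA mulVf// scale1r.
Unshelve. all: by end_near. Qed.

End Additivity.

(** A finite spanning family with continuous coordinate functions, not
    necessarily a basis. It reduces vector-valued functions to real-valued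
    ones and derivatives to partial derivatives. *)
Class findim (R : realType) (U : normedModType R) := FinDim {
  fd_ix : finType;
  fd_bas : fd_ix -> U;
  fd_crd : fd_ix -> U -> R;
  fd_lin : forall k (c : R) u v,
    fd_crd k (c *: u + v) = c * fd_crd k u + fd_crd k v;
  fd_cont : forall k, continuous (fd_crd k);
  fd_sum : forall u, u = \sum_k fd_crd k u *: fd_bas k }.

Arguments fd_ix {R} U {findim}.

Section Components.
Context {R : realType} {U W : normedModType R} {fW : findim W}.

Lemma fd_crd_linf k : is_linear (fd_crd k : W -> R).
Proof. exact: fd_lin. Qed.

Lemma linf_fdE (V : normedModType R) (L : W -> V) (lL : is_linear L) u :
  L u = \sum_k fd_crd k u *: L (fd_bas k).
Proof.
by rewrite {1}(fd_sum u) (linf_sum lL); apply: eq_bigr => k _; rewrite (linfZ lL).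
Qed.

(** A linear map is determined by its values on the family, through the
    continuous coordinates. *)
Lemma linf_continuous (V : normedModType R) (L : W -> V) : is_linear L -> continuous L.
Proof.
move=> lL u; rewrite (funext (linf_fdE lL)).
apply: cvg_sumf => k; apply: cvgZr_tmp; exact: fd_cont.
Qed.

End Components.

Section ComponentDerivatives.
Context {R : realType} {U W : normedModType R} {fW : findim W}.

Lemma fd_inj (a b : W) : (forall k, fd_crd k a = fd_crd k b) -> a = b.
Proof.
by move=> e; rewrite (fd_sum a) (fd_sum b); apply: eq_bigr => k _; rewrite e.
Qed.

Lemma is_derive_fd (f : U -> W) (z v : U) (df : W) :
  (forall k, is_derive z v (fun y => fd_crd k (f y) : R) (fd_crd k df : R)) ->
  is_derive z v f df.
Proof.
move=> H; rewrite (fd_sum df).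
have -> : f = fun y => \sum_k fd_crd k (f y) *: fd_bas k.
  by apply: funext => y; exact: fd_sum.
apply: is_derive_sumf => k.
have [dk <-] := H k.
apply: (is_derive_lin_comp (L := fun c : R => c *: fd_bas k)) => //.
  by move=> c a b; rewrite scalerDl scalerA.
by move=> c; apply: cvgZr_tmp.
Qed.

Lemma is_derive_crd k (f : U -> W) (z v : U) (df : W) :
  is_derive z v f df -> is_derive z v (fun y => fd_crd k (f y) : R) (fd_crd k df : R).
Proof.
move=> [dfz <-]; apply: (is_derive_lin_comp (L := fd_crd k : W -> R)) => //.
  exact: fd_crd_linf.
exact: fd_cont.
Qed.

Lemma is_deriveZf (g : U -> R) (f : U -> W) (z v : U) (dg : R) (df : W) :
  is_derive z v g dg -> is_derive z v f df ->
  is_derive z v (fun y => g y *: f y) (dg *: f z + g z *: df).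
Proof.
move=> dgz dfz; apply: is_derive_fd => k.
have -> : (fun y => fd_crd k (g y *: f y) : R) = g * (fun y => fd_crd k (f y) : R).
  by apply: funext => y; rewrite (linfZ (fd_crd_linf k)).
have dk := is_derive_crd k dfz.
apply: is_derive_eq; rewrite (linfD (fd_crd_linf k)) !(linfZ (fd_crd_linf k)) addrC.
by congr (_ + _); exact: mulrC.
Qed.

End ComponentDerivatives.

Section Coordinates.
Context {R : realType} {W : normedModType R} {fW : findim W}.

Lemma fd_crdD k (u v : W) : fd_crd k (u + v) = fd_crd k u + fd_crd k v.
Proof. exact: linfD (fd_crd_linf k) _ _. Qed.
Lemma fd_crdZ k c (u : W) : fd_crd k (c *: u) = c * fd_crd k u.
Proof. exact: linfZ (fd_crd_linf k) _ _. Qed.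
Lemma fd_crdN k (u : W) : fd_crd k (- u) = - fd_crd k u.
Proof. exact: linfN (fd_crd_linf k) _. Qed.
Lemma fd_crd0 k : fd_crd k (0 : W) = 0.
Proof. exact: linf0 (fd_crd_linf k). Qed.
Definition fd_crdE := (fd_crdD, fd_crdZ, fd_crdN, fd_crd0).

Lemma leibniz_cancel (f xf yf xyf yxf : R)
    (Z xZ yZ xyZ yxZ bZ xyZ' yxZ' bZ' : W) :
  (xyf *: Z + yf *: xZ + (xf *: yZ + f *: xyZ + xyZ'))
  - (yxf *: Z + xf *: yZ + (yf *: xZ + f *: yxZ + yxZ'))
  - ((xyf - yxf) *: Z + f *: bZ + bZ')
  = f *: (xyZ - yxZ - bZ) + (xyZ' - yxZ' - bZ').
Proof. by apply fd_inj => k; rewrite !fd_crdE; ring. Qed.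

End Coordinates.

Section C1.
Context {R : realType} {U W : normedModType R} {fW : findim W}.
Variables (A : set U) (f : U -> W).
Hypotheses (oA : open A) (f1 : Ck_on 1 A f).

Lemma C1_derivable z v : A z -> derivable f z v.
Proof. by move=> Az; have [_ /(_ v)[+ _]] := f1; exact. Qed.

(** The mean value theorem is only available for real values, so each
    coordinate of f is treated separately. *)
Lemma C1_linf z : A z -> is_linear (fun v => 'D_v f z).
Proof.
move=> Az c u v.
have [dcu <-] := is_deriveZv c (C1_derivable (v:=u) Az).
suff : is_derive z (c *: u + v) f ('D_(c *: u) f z + 'D_v f z) by case.
apply is_derive_fd => k; rewrite (linfD (fd_crd_linf k)).
pose fk (y : U) : R := fd_crd k (f y).
have dk y w : A y -> is_derive y w fk (fd_crd k ('D_w f y) : R).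
  by move=> Ay; apply/is_derive_crd/derivableP/C1_derivable.
have cz : fd_crd k ('D_v f y) @[y --> z] --> (fd_crd k ('D_v f z) : R).
  apply: continuous_cvg; first exact: fd_cont.
  by have [_ /(_ v)[_ [+ _]]] := f1; apply.
have cv : {for z, continuous (fun y => 'D_v fk y : R)}.
  suff : 'D_v fk y @[y --> z] --> ('D_v fk z : R) by [].
  have [_ ->] := dk z v Az.
  apply: cvg_trans cz; apply: near_eq_cvg; near=> y.
  have Ay : A y by near: y; exact: open_nbhs_nbhs.
  by have [_ ->] := dk y v Ay.
have [dzu <-] := dk z (c *: u) Az; have [_ <-] := dk z v Az.
apply: (is_deriveDv_real (f := fk) oA Az dzu _ cv) => y Ay.
by have [] := dk y v Ay.
Unshelve. all: by end_near. Qed.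

Context {fU : findim U}.

Lemma C1_deriveE z v : A z -> 'D_v f z = \sum_k fd_crd k v *: 'D_(fd_bas k) f z.
Proof. by move=> Az; apply: linf_fdE (C1_linf Az) v. Qed.

End C1.

Section Chain.
Context {R : realType} {T U W : normedModType R} {fU : findim U} {fW : findim W}.

(** By the mean value theorem, the difference quotient of f along g is a
    derivative of f at a point close to g t, in the direction of the
    difference quotient of g. Direction and base point converge together
    because directions are described by finitely many coordinates. *)
Lemma C1_chain (A : set U) (f : U -> W) (g : T -> U) (t v : T) :
  open A -> Ck_on 1 A f -> A (g t) -> derivable g t v ->
  is_derive t v (f \o g) ('D_('D_v g t) f (g t)).
Proof.
move=> oA f1 Agt dg; set q0 := 'D_v g t.
apply is_derive_fd => k.
pose fk (y : U) : R := fd_crd k (f y).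
pose dfk w (y : U) : R := fd_crd k ('D_w f y).
have dk y w : A y -> is_derive y w fk (dfk w y).
  by move=> Ay; apply/is_derive_crd/derivableP/(C1_derivable f1).
pose Psi (p : U * U) : R := \sum_j @fd_crd _ _ fU j p.1 *: dfk (fd_bas j) p.2.
have PsiE w y : A y -> Psi (w, y) = dfk w y.
  move=> Ay; rewrite /dfk (C1_deriveE oA f1 _ Ay) (linf_sum (fd_crd_linf k)).
  by apply: eq_bigr => j _; rewrite (linfZ (fd_crd_linf k)).
have cPsi : Psi p @[p --> (q0, g t)] --> Psi (q0, g t).
  apply: cvg_sumf => j; apply: cvgM.
    apply: (cvg_comp fst (fd_crd j : U -> R)); first exact: cvg_fst.
    exact: fd_cont.
  apply: (cvg_comp snd (fun y => dfk (fd_bas j) y)); first exact: cvg_snd.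
  apply: (cvg_comp (fun y => 'D_(fd_bas j) f y : W) (fd_crd k : W -> R)).
    by have [_ /(_ (fd_bas j))[_ [+ _]]] := f1; apply.
  exact: fd_cont.
rewrite -/(dfk q0 (g t)) -PsiE//.
pose q h : U := h^-1 *: (g (h *: v + t) - g t).
have cq : q h @[h --> 0^'] --> q0 by exact: dg.
suff H : (fun h => h^-1 *: ((fk \o g \o shift t) (h *: v) - fk (g t))) @ 0^'
    --> Psi (q0, g t).
  by apply: DeriveDef; [exact: (cvgP (Psi (q0, g t))) | exact/cvg_lim].
apply/cvgrPdist_le => /= e e0.
move/cvgrPdist_le : cPsi => /(_ e e0) /nbhs_ballP[r /= r0 Hr].
have : \forall y \near g t, A y /\ ball (g t) r y.
  by apply: filterI; [exact: open_nbhs_nbhs | exact: nbhsx_ballx].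
move=> /nbhs_ballP[s /= s0 Hs].
near=> h.
have h0 : h != 0 by near: h; exact: nbhs_dnbhs_neq.
have qr : ball q0 r (q h).
  by near: h; move/cvg_ballP : cq; apply.
have hq : `|h *: q h| < s.
  near: h; have : (h *: q h) @[h --> 0^'] --> 0 *: q0.
    by apply: cvgZ cq; exact: cvg_within.
  by rewrite scale0r => /cvgr0Pnorm_lt; apply.
have near_t (a : R) : 0 <= a <= 1 -> ball (g t) s (g t + a *: (h *: q h)).
  move=> /andP[a0 a1]; rewrite -ball_normE /ball_/= opprD addrA subrr sub0r normrN.
  by rewrite normrZ (le_lt_trans _ hq)// ger0_norm// ler_piMl.
have dfh y : ball (g t) s y -> derivable fk y (h *: q h).
  by move=> /Hs[Ay _]; have [] := dk y (h *: q h) Ay.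
have [a a01] := MVT_line near_t dfh.
have [Ay yr] := Hs _ (near_t _ a01).
have [dy _] := dk _ (q h) Ay.
have [_ ->] := is_deriveZv h dy.
have -> : g t + h *: q h = g (h *: v + t).
  by rewrite /q scalerA mulfV// scale1r addrC subrK.
move=> ->; rewrite (scalerA h^-1) mulVf// scale1r.
have [_ ->] := dk _ (q h) Ay.
by rewrite -PsiE//; apply: Hr; split.
Unshelve. all: by end_near. Qed.

End Chain.

(** * Symmetry of mixed derivatives *)

Section Schwarz.
Context {R : realType} {U : normedModType R}.

Lemma is_derive_shiftr (W : normedModType R) (f : U -> W) (z a v : U) :
  derivable f (z + a) v -> is_derive z v (fun y => f (y + a)) ('D_v f (z + a)).
Proof.
have E : (fun h : R => h^-1 *: (((fun y => f (y + a)) \o shift z) (h *: v) - f (z + a))) =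
  (fun h => h^-1 *: ((f \o shift (z + a)) (h *: v) - f (z + a))).
  by apply: funext => h /=; rewrite addrA.
move=> df; apply: DeriveDef; first by rewrite /derivable E.
by rewrite /derive E.
Qed.

(** The mean value theorem along u for the increment of f in the direction v,
    then along v for the derivative of f along u. *)
Lemma mixed_increment (f : U -> R) (B : set U) (z u v : U) :
  (forall s t : R, 0 <= s <= 1 -> 0 <= t <= 1 -> B (z + s *: u + t *: v)) ->
  (forall y, B y -> derivable f y u) ->
  (forall y, B y -> derivable (fun x => 'D_u f x : R) y v) ->
  exists2 p, B p &
  f (z + u + v) - f (z + u) - (f (z + v) - f z) = 'D_v (fun x => 'D_u f x : R) p.
Proof.
move=> zB dfu dfuv.
have zB0 (s : R) : 0 <= s <= 1 -> B (z + s *: u).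
  by move=> s01; have := zB s 0 s01; rewrite scale0r addr0 lexx ler01; apply.
have zB1 (s : R) : 0 <= s <= 1 -> B (z + s *: u + v).
  by move=> s01; have := zB s 1 s01; rewrite scale1r lexx ler01; apply.
pose phi (y : U) : R := f (y + v) - f y.
have dphi y : B y -> B (y + v) -> is_derive y u phi ('D_u f (y + v) - 'D_u f y).
  move=> By Byv; have dv := is_derive_shiftr (dfu _ Byv).
  have dy := derivableP (dfu _ By).
  exact: is_deriveB.
have [||s s01 ->] := @MVT_line _ _ phi z u [set y | B y /\ B (y + v)].
- by move=> t t01; split; [exact: zB0 | exact: zB1].
- by move=> y [By Byv]; have [] := dphi y By Byv.
have [_ ->] := dphi _ (zB0 _ s01) (zB1 _ s01).
have [||t t01 ->] := @MVT_line _ _ (fun x => 'D_u f x : R) (z + s *: u) v B.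
- by move=> t t01; exact: zB.
- exact: dfuv.
by exists (z + s *: u + t *: v) => //; exact: zB.
Qed.

(** The increment of f over a small parallelogram does not depend on the order
    of its sides, so the two mixed derivatives agree at points that are
    arbitrarily close to z. *)
Lemma schwarz_real (f : U -> R) (A : set U) (z u v : U) :
  open A -> A z ->
  (forall y, A y -> derivable f y u) -> (forall y, A y -> derivable f y v) ->
  (forall y, A y -> derivable (fun x => 'D_u f x : R) y v) ->
  (forall y, A y -> derivable (fun x => 'D_v f x : R) y u) ->
  {for z, continuous (fun y => 'D_v (fun x => 'D_u f x : R) y : R)} ->
  {for z, continuous (fun y => 'D_u (fun x => 'D_v f x : R) y : R)} ->
  'D_v (fun x => 'D_u f x : R) z = 'D_u (fun x => 'D_v f x : R) z.
Proof.
move=> oA Az dfu dfv dfuv dfvu cuv cvu.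
apply/eqP; rewrite -subr_eq0 -normr_le0; apply/ler_addgt0Pr => e e0; rewrite add0r.
have e20 : 0 < e / 2 by rewrite divr_gt0.
have nA : nbhs z A by exact: open_nbhs_nbhs.
pose P y : R := 'D_v (fun x => 'D_u f x : R) y.
pose Q y : R := 'D_u (fun x => 'D_v f x : R) y.
pose BP : set U := [set y | `|P z - P y| <= e / 2].
pose BQ : set U := [set y | `|Q z - Q y| <= e / 2].
have nP : nbhs z BP by move/cvgrPdist_le : cuv => /(_ _ e20).
have nQ : nbhs z BQ by move/cvgrPdist_le : cvu => /(_ _ e20).
have nAPQ : nbhs z (A `&` (BP `&` BQ)) by exact: filterI nA (filterI nP nQ).
have [r /= r0 Hr] := (nbhs_ballP z _).1 nAPQ.
(* h is so small that the parallelogram spanned by h u and h v stays in the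
   ball; the summand 1 keeps k positive when u and v vanish *)
pose k := `|u| + `|v| + 1.
have k0 : 0 < k by rewrite ltr_wpDl// addr_ge0.
have [h h0 hk] : exists2 h : R, 0 < h & h * k < r.
  exists (r / k / 2); first by rewrite !divr_gt0.
  by rewrite mulrAC divfK ?gt_eqf//; lra.
have sub_ball (s t : R) : 0 <= s <= 1 -> 0 <= t <= 1 ->
    ball z r (z + s *: (h *: u) + t *: (h *: v)).
  move=> /andP[s0 s1] /andP[t0 t1].
  rewrite -ball_normE /ball_/= -addrA opprD addrA subrr sub0r normrN.
  rewrite (le_lt_trans (ler_normD _ _))// (le_lt_trans _ hk)// !normrZ.
  rewrite (ger0_norm (ltW h0)) (ger0_norm s0) (ger0_norm t0) !(mulrCA _ h) -mulrDr.
  by rewrite ler_wpM2l ?(ltW h0)// /k ler_wpDr// lerD// ler_piMl.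
have scaled a b : (forall y, A y -> derivable f y a) ->
    (forall y, A y -> derivable (fun x => 'D_a f x : R) y b) ->
    forall y, ball z r y -> is_derive y (h *: b) (fun x => 'D_(h *: a) f x : R)
      (h *: (h *: 'D_b (fun x => 'D_a f x : R) y)).
  move=> dfa dfab y zy.
  apply: (near_eq_is_derive (f := fun x => h *: ('D_a f x : R))).
    have : \forall x \near y, ball z r x.
      by apply: open_nbhs_nbhs; split => //; exact: ball_open.
    apply: filterS => x /Hr[Ax _].
    by have [_ ->] := is_deriveZv h (dfa _ Ax).
  have [Ay _] := Hr _ zy.
  have [d1 <-] := is_deriveZv h (dfab _ Ay).
  apply: is_deriveZ; exact: derivableP.
have dscaled a b : (forall y, A y -> derivable f y a) ->
    (forall y, A y -> derivable (fun x => 'D_a f x : R) y b) ->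
    forall y, ball z r y -> derivable (fun x => 'D_(h *: a) f x : R) y (h *: b).
  by move=> dfa dfab y zy; have [] := scaled a b dfa dfab y zy.
have dZ a : (forall y, A y -> derivable f y a) ->
    forall y, ball z r y -> derivable f y (h *: a).
  by move=> dfa y /Hr[Ay _]; have [] := is_deriveZv h (dfa _ Ay).
have [p zp] := mixed_increment sub_ball (dZ _ dfu)
  (dscaled u v dfu dfuv).
have [_ ->] := scaled u v dfu dfuv p zp => e1.
have sub_ball' (s t : R) : 0 <= s <= 1 -> 0 <= t <= 1 -> ball z r (z + s *: (h *: v) + t *: (h *: u)).
  by move=> s01 t01; rewrite addrAC; exact: sub_ball.
have [p' zp'] := mixed_increment sub_ball' (dZ _ dfv)
  (dscaled v u dfv dfvu).
have [_ ->] := scaled v u dfv dfvu p' zp' => e2.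
have swap (a b c d : R) : a - b - (c - d) = a - c - (b - d) by ring.
have e12 : f (z + h *: u + h *: v) - f (z + h *: u) - (f (z + h *: v) - f z) =
    f (z + h *: v + h *: u) - f (z + h *: v) - (f (z + h *: u) - f z).
  by rewrite (addrAC z (h *: v)); exact: swap.
have := etrans (esym e1) (etrans e12 e2).
move=> /(scalerI (lt0r_neq0 h0)) /(scalerI (lt0r_neq0 h0)) e3.
have [_ [le1 _]] := Hr _ zp; have [_ [_ le2]] := Hr _ zp'.
have {}le2 : `|P p - Q z| <= e / 2 by rewrite [P p]e3 distrC.
have {}le1 : `|P z - P p| <= e / 2 by exact: le1.
rewrite -(subrKA (P p)) (splitr e).
exact: le_trans (ler_normD _ _) (lerD le1 le2).
Unshelve. all: by end_near. Qed.

End Schwarz.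

Section C2.
Context {R : realType} {U W : normedModType R} {fW : findim W}.

Lemma schwarz (A : set U) (f : U -> W) (z u v : U) :
  open A -> Ck_on 2 A f -> A z ->
  'D_u (fun y => 'D_v f y) z = 'D_v (fun y => 'D_u f y) z.
Proof.
move=> oA [_ f2] Az.
have df w y : A y -> derivable f y w by move=> Ay; have [+ _] := f2 w; apply.
have df2 w w' y : A y -> derivable (fun x => 'D_w f x : W) y w'.
  by move=> Ay; have [_ [_ /(_ w')[+ _]]] := f2 w; apply.
have cf2 w w' y : A y -> {for y, continuous (fun x => 'D_w' (fun x => 'D_w f x : W) x : W)}.
  by move=> Ay; have [_ [_ /(_ w')[_ [+ _]]]] := f2 w; apply.
apply fd_inj => k.
pose fk (y : U) : R := fd_crd k (f y).
have d1 w y : A y -> is_derive y w fk (fd_crd k ('D_w f y) : R).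
  by move=> Ay; apply/is_derive_crd/derivableP/df.
have d2 w w' y : A y -> is_derive y w' (fun x => 'D_w fk x : R)
    (fd_crd k ('D_w' (fun x => 'D_w f x : W) y) : R).
  move=> Ay.
  apply: (near_eq_is_derive (f := fun x => fd_crd k ('D_w f x) : R)).
    near=> x; have Ax : A x by near: x; exact: open_nbhs_nbhs.
    by have [_ ->] := d1 w x Ax.
  by apply/is_derive_crd/derivableP/df2.
have c2 w w' : {for z, continuous (fun x => 'D_w' (fun x => 'D_w fk x : R) x : R)}.
  suff : 'D_w' (fun x => 'D_w fk x : R) y @[y --> z] --> ('D_w' (fun x => 'D_w fk x : R) z : R) by [].
  have [_ ->] := d2 w w' z Az.
  have cz : fd_crd k ('D_w' (fun x => 'D_w f x : W) y) @[y --> z] -->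
      (fd_crd k ('D_w' (fun x => 'D_w f x : W) z) : R).
    by apply: continuous_cvg; [exact: fd_cont | exact: cf2].
  apply: cvg_trans cz; apply: near_eq_cvg; near=> y.
  have Ay : A y by near: y; exact: open_nbhs_nbhs.
  by have [_ ->] := d2 w w' y Ay.
have [_ <-] := d2 v u z Az; have [_ <-] := d2 u v z Az.
apply: (schwarz_real (f := fk) oA Az _ _ _ _ (c2 _ _) (c2 _ _)) => y Ay.
- by have [] := d1 v y Ay.
- by have [] := d1 u y Ay.
- by have [] := d2 v u y Ay.
- by have [] := d2 u v y Ay.
Unshelve. all: by end_near. Qed.

End C2.

(** * Smooth functions on an open set *)

(** The directional derivative, sealed: comparing two derivatives should not
    unfold them to limits. *)
Fact dirD_sealed : {D : forall (R : realType) (U W : normedModType R),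
  U -> (U -> W) -> U -> W | D = fun R U W v f z => 'D_v f z}.
Proof. by exists (fun R U W v f z => 'D_v f z). Qed.

Definition dirD {R : realType} {U W : normedModType R} : U -> (U -> W) -> U -> W :=
  sval dirD_sealed R U W.

Notation "''d_' v f" := (dirD v f) (at level 10, v at next level,
  format "''d_' v  f").

Lemma dirDE (R : realType) (U W : normedModType R) (v : U) (f : U -> W) :
  'd_v f = fun z => 'D_v f z.
Proof. by rewrite /dirD; case: dirD_sealed => D /= ->. Qed.

Section SmoothBasics.
Context {R : realType} {U W : normedModType R}.
Implicit Types (A : set U) (f g : U -> W).

Lemma near_open A f g z : open A -> A z -> (forall y, A y -> f y = g y) ->
  \forall y \near z, f y = g y.
Proof.
by move=> oA Az fg; have := open_nbhs_nbhs (conj oA Az); apply: filterS.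
Qed.

Lemma derive_open_ext A f g z v : open A -> A z -> (forall y, A y -> f y = g y) ->
  'D_v f z = 'D_v g z.
Proof. by move=> oA Az fg; apply: near_eq_derive; apply: near_open fg. Qed.

Lemma smooth_cont A f z : smooth_on A f -> A z -> {for z, continuous f}.
Proof. by move=> /(_ 0%N)[+ _]; apply. Qed.

Lemma smooth_derivable A f z v : smooth_on A f -> A z -> derivable f z v.
Proof. by move=> /(_ 1%N)[_ /(_ v)[+ _]]; apply. Qed.

Lemma smooth_derive A f v : smooth_on A f -> smooth_on A (fun z => 'D_v f z : W).
Proof. by move=> smf k; have [_ /(_ v)[_ +]] := smf k.+1. Qed.

Lemma smooth_is_derive A f z v : smooth_on A f -> A z ->
  is_derive z v f ('D_v f z).
Proof. by move=> smf Az; apply/derivableP; apply: smooth_derivable smf Az. Qed.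

Lemma sub_smooth A B f : B `<=` A -> smooth_on A f -> smooth_on B f.
Proof.
move=> BA smf k; have := smf k; elim: k f {smf} => [|k IHk] f [cf df];
  (split=> [z /BA Az|//]; first exact: cf).
move=> v; have [dfv Cfv] := df v; split=> [z /BA Az|]; first exact: dfv.
exact: IHk.
Qed.

Lemma Ck_ext A k f g : open A -> (forall y, A y -> f y = g y) ->
  Ck_on k A f -> Ck_on k A g.
Proof.
move=> oA; elim: k f g => [|k IHk] f g fg [cf df]; (split=> [z Az|//];
  first by suff : g x @[x --> z] --> g z by []; rewrite -(fg _ Az); apply: cvg_trans (cf z Az);
    apply: near_eq_cvg; apply: near_open fg).
move=> v.
have [dfv Cfv] := df v; split=> [z Az|].
  by apply: near_eq_derivable (dfv z Az); apply: near_open fg.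
by apply: IHk Cfv => y Ay; apply: derive_open_ext fg.
Qed.

Lemma smooth_ext A f g : open A -> (forall y, A y -> f y = g y) ->
  smooth_on A f -> smooth_on A g.
Proof. by move=> oA fg smf k; apply: Ck_ext (smf k). Qed.

Lemma smooth_cst A (c : W) : smooth_on A (fun _ => c).
Proof.
move=> k; elim: k c => [|k IHk] c; split=> //; try by move=> z _; exact: cvg_cst.
move=> v; split; first by move=> z _; exact: derivable_cst.
have -> : (fun z => 'D_v (fun _ : U => c) z) = fun=> 0 by apply: funext => z; exact: derive_cst.
exact: IHk.
Qed.

Lemma dirD_ext A f g z v : open A -> A z -> (forall y, A y -> f y = g y) ->
  'd_v f z = 'd_v g z.
Proof. by rewrite !dirDE; exact: derive_open_ext. Qed.

Lemma dirD0 f z : 'd_0 f z = 0.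
Proof. by rewrite dirDE derive0. Qed.

Lemma dirD_cst (c : W) z v : 'd_v (fun _ : U => c) z = 0.
Proof. by rewrite dirDE; exact: derive_cst. Qed.

Lemma smooth_dirD A f v : smooth_on A f -> smooth_on A (fun z => 'd_v f z).
Proof. by rewrite dirDE; exact: smooth_derive. Qed.

Lemma CkD A k f g : open A -> Ck_on k A f -> Ck_on k A g ->
  Ck_on k A (fun z => f z + g z).
Proof.
move=> oA; elim: k f g => [|k IHk] f g [cf df] [cg dg]; split=> //;
  try by move=> z Az; apply: cvgD; [exact: cf|exact: cg].
move=> v; have [dfv Cfv] := df v; have [dgv Cgv] := dg v; split=> [z Az|].
  by apply: derivableD; [exact: dfv|exact: dgv].
apply: Ck_ext oA _ (IHk _ _ Cfv Cgv) => y Ay.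
by rewrite [RHS]deriveD//; [exact: dfv|exact: dgv].
Qed.

Lemma smoothD A f g : open A -> smooth_on A f -> smooth_on A g ->
  smooth_on A (fun z => f z + g z).
Proof. by move=> oA smf smg k; apply: CkD. Qed.

Lemma smooth_sum A (I : finType) (h : I -> U -> W) : open A ->
  (forall i, smooth_on A (h i)) -> smooth_on A (fun z => \sum_i h i z).
Proof.
move=> oA sh; elim: (index_enum I) => [|i s IHs].
  by under eq_fun do rewrite big_nil; exact: smooth_cst.
by under eq_fun do rewrite big_cons; exact: smoothD.
Qed.

End SmoothBasics.

Lemma smooth_linf_comp (R : realType) (U W W' : normedModType R) (A : set U)
    (L : W -> W') (f : U -> W) : open A ->
  is_linear L -> continuous L -> smooth_on A f -> smooth_on A (fun z => L (f z)).
Proof.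
move=> oA lL cL smf k; elim: k f smf => [|k IHk] f smf; (split=> [z Az|//];
  first exact: (continuous_comp (smooth_cont smf Az) (cL _))).
have dL v y : A y -> is_derive y v (L \o f) (L ('D_v f y)).
  by move=> Ay; apply: is_derive_lin_comp => //; apply: smooth_derivable Ay.
move=> v; split=> [z Az|]; first by have [] := dL v z Az.
apply: Ck_ext oA _ (IHk _ (smooth_derive v smf)) => y Ay.
by have [_ ->] := dL v y Ay.
Qed.

Section SmoothLinear.
Context {R : realType} {U W : normedModType R}.
Implicit Types (A : set U) (f g : U -> W).

Lemma smoothZ_cst A (c : R) f : open A -> smooth_on A f ->
  smooth_on A (fun z => c *: f z).
Proof.
move=> oA smf; apply: (smooth_linf_comp oA (L := fun w => c *: w)) => //.
  by move=> a u v; rewrite scalerDr !scalerA mulrC.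
by move=> w; apply: cvgZl_tmp.
Qed.

Lemma smoothN A f : open A -> smooth_on A f -> smooth_on A (fun z => - f z).
Proof.
by move=> oA smf; under eq_fun do rewrite -scaleN1r; exact: smoothZ_cst.
Qed.

Lemma smoothB A f g : open A -> smooth_on A f -> smooth_on A g ->
  smooth_on A (fun z => f z - g z).
Proof. by move=> oA smf smg; apply: smoothD => //; exact: smoothN. Qed.

End SmoothLinear.

Lemma is_derive_comp_linf (R : realType) (T U W : normedModType R) (L : T -> U)
    (f : U -> W) z v : is_linear L -> derivable f (L z) (L v) ->
  is_derive z v (f \o L) ('D_(L v) f (L z)).
Proof.
move=> lL.
have E : (fun h : R => h^-1 *: (((f \o L) \o shift z) (h *: v) - f (L z))) =
  (fun h => h^-1 *: ((f \o shift (L z)) (h *: L v) - f (L z))).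
  by apply: funext => h /=; rewrite lL.
move=> df; apply: DeriveDef; first by rewrite /derivable E.
by rewrite /derive E.
Qed.

Lemma smooth_comp_linf (R : realType) (T U W : normedModType R) (A : set U)
    (L : T -> U) (f : U -> W) : is_linear L -> continuous L -> open A ->
  smooth_on A f -> smooth_on (L @^-1` A) (f \o L).
Proof.
move=> lL cL oA smf k.
have oLA : open (L @^-1` A) by apply: open_comp => // z _; exact: cL.
elim: k f smf => [|k IHk] f smf; (split=> [z Az|//];
  first exact: (continuous_comp (cL z) (smooth_cont smf Az))).
have d v y : (L @^-1` A) y -> is_derive y v (f \o L) ('D_(L v) f (L y)).
  by move=> Ay; apply: is_derive_comp_linf => //; exact: smooth_derivable smf (Ay : A (L y)).
move=> v; split=> [z Az|]; first by have [] := d v z Az.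
apply: Ck_ext oLA _ (IHk _ (smooth_derive (L v) smf)) => y Ay.
by have [_ ->] := d v y Ay.
Qed.

Section SmoothComponents.
Context {R : realType} {U W : normedModType R} {fW : findim W}.
Variables (A : set U).
Hypothesis oA : open A.
Implicit Types (f : U -> W) (g : U -> R).

Lemma smooth_crd k f : smooth_on A f -> smooth_on A (fun z => fd_crd k (f z) : R).
Proof.
move=> smf; apply: (smooth_linf_comp oA (L := fd_crd k : W -> R)) smf.
  exact: fd_crd_linf.
exact: fd_cont.
Qed.

Lemma smoothZ g f : smooth_on A g -> smooth_on A f ->
  smooth_on A (fun z => g z *: f z).
Proof.
move=> smg smf k; elim: k g f smg smf => [|k IHk] g f smg smf; split=> //;
  try by move=> z Az; apply: cvgZ; apply: smooth_cont Az.
have d v y : A y -> is_derive y v (fun z => g z *: f z) ('D_v g y *: f y + g y *: 'D_v f y).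
  by move=> Ay; apply is_deriveZf; exact: smooth_is_derive Ay.
move=> v; split=> [z Az|]; first by have [] := d v z Az.
apply: Ck_ext oA _ (CkD oA (IHk _ _ (smooth_derive v smg) smf)
  (IHk _ _ smg (smooth_derive v smf))) => y Ay.
by have [_ ->] := d v y Ay.
Qed.

Lemma dirD_linf f z : smooth_on A f -> A z -> is_linear (fun v => 'd_v f z).
Proof.
by move=> /(_ 1%N) smf Az c u v; rewrite !dirDE; exact (C1_linf oA smf Az c u v).
Qed.

Lemma dirD_schwarz f z u v : smooth_on A f -> A z ->
  'd_u (fun y => 'd_v f y) z = 'd_v (fun y => 'd_u f y) z.
Proof. by move=> /(_ 2%N) smf Az; rewrite !dirDE (schwarz u v oA smf Az). Qed.

End SmoothComponents.

(** * Smooth families of linear maps *)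

Section LinearFamilies.
Context {R : realType} {U V W : normedModType R} {fV : findim V} {fW : findim W}.
Variables (A : set U).
Hypothesis oA : open A.

(** A smooth section of Hom(V, W) over A. *)
Definition linfam (L : U -> V -> W) :=
  (forall z, A z -> is_linear (L z)) /\ (forall a, smooth_on A (fun z => L z a)).

Variables (L : U -> V -> W) (w : U -> V).
Hypotheses (famL : linfam L) (smw : smooth_on A w).

Lemma linfamE z : A z ->
  L z (w z) = \sum_k fd_crd k (w z) *: L z (fd_bas k).
Proof. by move=> Az; rewrite (linf_fdE (famL.1 z Az)). Qed.

Lemma smooth_linfam : smooth_on A (fun z => L z (w z)).
Proof.
apply: (smooth_ext (f := fun z => \sum_k @fd_crd _ _ fV k (w z) *: L z (fd_bas k))) => //.
  by move=> z Az; rewrite linfamE.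
apply: smooth_sum => // k; apply smoothZ => //; last exact: famL.2.
exact: smooth_crd.
Qed.

(** The Leibniz rule for the evaluation of L on w, from the product rule on
    the coordinates of w. *)
Lemma dirD_linfam z v : A z ->
  'd_v (fun y => L y (w y)) z = 'd_v (fun y => L y (w z)) z + L z ('d_v w z).
Proof.
move=> Az; rewrite (dirD_ext _ oA Az linfamE).
have famLw : forall y, A y -> L y (w z) = \sum_k @fd_crd _ _ fV k (w z) *: L y (fd_bas k).
  by move=> y Ay; rewrite (linf_fdE (famL.1 y Ay)).
rewrite (dirD_ext _ oA Az famLw) (linf_fdE (famL.1 z Az)) !dirDE.
have dL k : is_derive z v (fun y => L y (@fd_bas _ _ fV k)) ('D_v (fun y => L y (fd_bas k)) z).
  exact: smooth_is_derive (famL.2 _) Az.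
have dw k : is_derive z v (fun y => @fd_crd _ _ fV k (w y) : R) (fd_crd k ('D_v w z) : R).
  by apply: is_derive_crd; exact: smooth_is_derive smw Az.
have [_ ->] := is_derive_sumf (fun k => is_deriveZf (dw k) (dL k)).
have dc k : is_derive z v (fun y => @fd_crd _ _ fV k (w z) *: L y (fd_bas k))
    (fd_crd k (w z) *: 'D_v (fun y => L y (fd_bas k)) z) by exact: is_deriveZ.
have [_ ->] := is_derive_sumf dc.
by rewrite -big_split/=; apply: eq_bigr => k _; rewrite addrC.
Qed.

End LinearFamilies.

Section DirectionalFamily.
Context {R : realType} {U W : normedModType R} {fU : findim U} {fW : findim W}.
Variables (A : set U) (f : U -> W) (X : U -> U).
Hypotheses (oA : open A) (smf : smooth_on A f) (smX : smooth_on A X).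

Lemma linfam_dirD : linfam A (fun z v => 'd_v f z).
Proof. by split=> [z Az|v]; [exact: dirD_linf smf Az|exact: smooth_dirD]. Qed.

Lemma smooth_dirD_along : smooth_on A (fun z => 'd_(X z) f z).
Proof. exact: (smooth_linfam oA linfam_dirD smX). Qed.

(** The case where L is the differential of f: a second derivative at a fixed
    direction, plus the derivative of f along the change of direction. *)
Lemma dirD_dirD_along z v : A z ->
  'd_v (fun y => 'd_(X y) f y) z
  = 'd_v (fun y => 'd_(X z) f y) z + 'd_('d_v X z) f z.
Proof. by move=> Az; rewrite (dirD_linfam oA linfam_dirD smX). Qed.

End DirectionalFamily.

Lemma dirD_chain (R : realType) (U V W : normedModType R)
    {fV : findim V} {fW : findim W}
    (A : set U) (B : set V) (f : V -> W) (g : U -> V) z v :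
  open B -> smooth_on A g -> smooth_on B f -> A z -> B (g z) ->
  'd_v (f \o g) z = 'd_('d_v g z) f (g z).
Proof.
move=> oB smg smf Az Bgz; rewrite !dirDE.
have dg : derivable g z v by apply: smooth_derivable Az.
by have [_ ->] := C1_chain oB (smf 1%N) Bgz dg.
Qed.

(** * Coordinate spaces *)

Section Instances.
Context {R : realType}.

Lemma fd_real_sum (u : R) : u = \sum_(k : unit) u *: (1 : R).
Proof. by rewrite big_const card_unit /= addr0 [_ *: _]mulr1. Qed.

Local Obligation Tactic := idtac.

#[export] Program Instance findim_real : findim (R : normedModType R) :=
  @FinDim R (R : normedModType R) unit (fun _ => 1 : R) (fun _ u => u) _ _ _.
Next Obligation. by []. Qed.
Next Obligation. by move=> k u; exact: cvg_id. Qed.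
Next Obligation. by move=> u; exact: fd_real_sum. Qed.

#[export] Program Instance findim_rV n : findim ('rV[R]_n : normedModType R) :=
  @FinDim R _ 'I_n (fun k => delta_mx 0 k) (fun k u => u 0 k) _ _ _.
Next Obligation. by move=> n k c u v /=; rewrite !mxE. Qed.
Next Obligation. by move=> n k; exact: coord_continuous. Qed.
Next Obligation. by move=> n u; exact: row_sum_delta. Qed.

Context {U V : normedModType R} {fU : findim U} {fV : findim V}.

#[export] Program Instance findim_prod : findim ((U * V)%type : normedModType R) :=
  @FinDim R _ (fd_ix U + fd_ix V)%type
    (fun k => match k with inl a => (fd_bas a, 0) | inr b => (0, fd_bas b) end)
    (fun k u => match k with inl a => fd_crd a u.1 | inr b => fd_crd b u.2 end)
    _ _ _.
Next Obligation. by case=> k c u v /=; exact: fd_lin. Qed.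
Next Obligation.
case=> k u /=.
  by apply: (cvg_comp fst (fd_crd k : U -> R)); [exact: cvg_fst|exact: fd_cont].
by apply: (cvg_comp snd (fd_crd k : V -> R)); [exact: cvg_snd|exact: fd_cont].
Qed.
Next Obligation.
case=> a b; rewrite big_sumType /=.
rewrite [X in X + _](_ : _ = (a, 0)); last first.
  rewrite [in RHS](fd_sum a).
  have lE : is_linear (fun u : U => (u, 0) : U * V).
    by move=> c u v; congr (_, _) => /=; rewrite scaler0 addr0.
  rewrite (linf_sum lE); apply: eq_bigr => k _; congr (_, _) => /=.
  by rewrite scaler0.
rewrite [X in _ + X](_ : _ = (0, b)); last first.
  rewrite [in RHS](fd_sum b).
  have lE : is_linear (fun u : V => (0, u) : U * V).
    by move=> c u v; congr (_, _) => /=; rewrite scaler0 addr0.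
  rewrite (linf_sum lE); apply: eq_bigr => k _; congr (_, _) => /=.
  by rewrite scaler0.
by congr (_, _) => /=; rewrite ?addr0 ?add0r.
Qed.

End Instances.

#[export] Instance findim_TV (R : realType) n : findim (TV R n) := findim_prod.

Section LinearMaps.
Context {R : realType} {U V W : normedModType R}.
Variables (A : set U).
Hypothesis oA : open A.

Lemma linf_id : is_linear (@id U). Proof. by []. Qed.
Lemma linf_fst : is_linear (@fst U V). Proof. by []. Qed.
Lemma linf_snd : is_linear (@snd U V). Proof. by []. Qed.
Lemma linf_inl : is_linear (fun u : U => (u, 0) : U * V).
Proof. by move=> c u v; congr (_, _) => /=; rewrite scaler0 addr0. Qed.
Lemma linf_inr : is_linear (fun u : V => (0, u) : U * V).
Proof. by move=> c u v; congr (_, _) => /=; rewrite scaler0 addr0. Qed.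

Lemma dirD_linf_comp (L : V -> W) (f : U -> V) z v : is_linear L -> continuous L ->
  smooth_on A f -> A z -> 'd_v (fun y => L (f y)) z = L ('d_v f z).
Proof.
move=> lL cL smf Az; rewrite !dirDE; have dfz : derivable f z v by apply: smooth_derivable Az.
by have [_ ->] := is_derive_lin_comp lL cL dfz.
Qed.

Lemma dirD_linf_map (L : U -> W) z v : is_linear L -> continuous L -> 'd_v L z = L v.
Proof.
move=> lL cL; rewrite dirDE; have did : derivable id z v by exact: derivable_id.
by have [_ ->] := is_derive_lin_comp lL cL did; rewrite derive_id.
Qed.

Lemma smooth_linf_map (L : U -> W) : is_linear L -> continuous L -> smooth_on A L.
Proof.
move=> lL cL [|k]; (split=> [z _|//]; first exact: cL) => v; split=> [z _|].
  have did : derivable id z v by exact: derivable_id.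
  by have [] := is_derive_lin_comp lL cL did.
have e : (fun z => L v) = 'd_v L.
  by apply: funext => z; rewrite dirD_linf_map.
by move: e; rewrite dirDE => <-; exact: smooth_cst.
Qed.

Lemma continuous_inl : continuous (fun u : U => (u, 0) : U * V).
Proof. by move=> u; apply: cvg_pair; [exact: cvg_id|exact: cvg_cst]. Qed.

Lemma continuous_inr : continuous (fun u : V => (0, u) : U * V).
Proof. by move=> u; apply: cvg_pair; [exact: cvg_cst|exact: cvg_id]. Qed.

Lemma continuous_fst : continuous (@fst U V). Proof. by move=> u; exact: cvg_fst. Qed.
Lemma continuous_snd : continuous (@snd U V). Proof. by move=> u; exact: cvg_snd. Qed.

End LinearMaps.

Section Pairs.
Context {R : realType} {U V W : normedModType R}.
Variables (A : set U).
Hypothesis oA : open A.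

Lemma smooth_fst (f : U -> V * W) : smooth_on A f -> smooth_on A (fun z => (f z).1).
Proof. by apply: smooth_linf_comp => // z; exact: cvg_fst. Qed.
Lemma smooth_snd (f : U -> V * W) : smooth_on A f -> smooth_on A (fun z => (f z).2).
Proof. by apply: smooth_linf_comp => // z; exact: cvg_snd. Qed.

Lemma smooth_pair (f : U -> V) (g : U -> W) : smooth_on A f -> smooth_on A g ->
  smooth_on A (fun z => (f z, g z)).
Proof.
move=> smf smg; apply: (smooth_ext (f := fun z => (f z, 0) + (0, g z))) => //.
  by move=> z Az; congr (_, _) => /=; rewrite ?addr0 ?add0r.
apply: smoothD => //.
  apply: (smooth_linf_comp oA (L := fun u : V => (u, 0) : V * W)) smf.
    exact: linf_inl.
  exact: continuous_inl.
apply: (smooth_linf_comp oA (L := fun u : W => (0, u) : V * W)) smg.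
  exact: linf_inr.
exact: continuous_inr.
Qed.

Lemma dirD_fst (f : U -> V * W) z v : smooth_on A f -> A z ->
  'd_v (fun y => (f y).1) z = ('d_v f z).1.
Proof. by move=> smf Az; apply: (dirD_linf_comp (L := fst)) smf Az => // u; exact: cvg_fst. Qed.

Lemma dirD_snd (f : U -> V * W) z v : smooth_on A f -> A z ->
  'd_v (fun y => (f y).2) z = ('d_v f z).2.
Proof. by move=> smf Az; apply: (dirD_linf_comp (L := snd)) smf Az => // u; exact: cvg_snd. Qed.

Lemma dirD_pair (f : U -> V) (g : U -> W) z v : smooth_on A f -> smooth_on A g -> A z ->
  'd_v (fun y => (f y, g y)) z = ('d_v f z, 'd_v g z).
Proof.
move=> smf smg Az; have smfg := smooth_pair smf smg.
by rewrite [LHS]surjective_pairing -(dirD_fst v smfg Az) -(dirD_snd v smfg Az).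
Qed.

End Pairs.

Section SmoothRules.
Context {R : realType} {U V : normedModType R}.
Variables (A : set U).

Lemma dirDD (f g : U -> V) z v : smooth_on A f -> smooth_on A g -> A z ->
  'd_v (fun y => f y + g y) z = 'd_v f z + 'd_v g z.
Proof. by move=> smf smg Az; rewrite !dirDE [LHS]deriveD//; apply: smooth_derivable Az. Qed.

Lemma dirDB (f g : U -> V) z v : smooth_on A f -> smooth_on A g -> A z ->
  'd_v (fun y => f y - g y) z = 'd_v f z - 'd_v g z.
Proof. by move=> smf smg Az; rewrite !dirDE [LHS]deriveB//; apply: smooth_derivable Az. Qed.

Lemma dirDZ (f : U -> V) (c : R) z v : smooth_on A f -> A z ->
  'd_v (fun y => c *: f y) z = c *: 'd_v f z.
Proof. by move=> smf Az; rewrite !dirDE [LHS]deriveZ//; apply: smooth_derivable Az. Qed.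

End SmoothRules.

(** * Homogeneity in the fibre variable *)

Section Homogeneity.
Context {R : realType} {n : nat}.
Variables (A : set (TV R n)).
Hypothesis oA : open A.

Definition vert (b : 'rV[R]_n) : TV R n := (0, b).
Definition hor (a : 'rV[R]_n) : TV R n := (a, 0).

Lemma linf_vert : is_linear vert. Proof. exact: linf_inr. Qed.
Lemma linf_hor : is_linear hor. Proof. exact: linf_inl. Qed.
Lemma continuous_vert : continuous vert. Proof. exact: continuous_inr. Qed.
Lemma vert0 : vert 0 = 0. Proof. by []. Qed.
Lemma horDvert (a : TV R n) : a = hor a.1 + vert a.2.
Proof. by case: a => a b; congr (_, _) => /=; rewrite ?addr0 ?add0r. Qed.
Lemma TV_vert (a : TV R n) : a.1 = 0 -> a = vert a.2.
Proof. by case: a => a b /= ->. Qed.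

Lemma linf_tangentJ : is_linear (@tangentJ R n).
Proof. by move=> c a b; congr (_, _) => /=; rewrite scaler0 addr0. Qed.

Lemma liouville_vert (z : TV R n) : liouville z = vert z.2. Proof. by []. Qed.

Lemma linf_liouville : is_linear (@liouville R n).
Proof. by move=> c a b; congr (_, _) => /=; rewrite scaler0 addr0. Qed.

Lemma smooth_liouville : smooth_on A (@liouville R n).
Proof.
apply: smooth_linf_map => //; first exact: linf_liouville.
apply linf_continuous; exact: linf_liouville.
Qed.

Lemma dirD_liouville (z a : TV R n) : 'd_a (@liouville R n) z = vert a.2.
Proof.
rewrite dirD_linf_map//; first exact: linf_liouville.
apply linf_continuous; exact: linf_liouville.
Qed.

Lemma smooth_vert (w : TV R n -> 'rV[R]_n) : smooth_on A w ->
  smooth_on A (fun z => vert (w z)).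
Proof. exact: smooth_linf_comp oA linf_vert continuous_vert. Qed.

Lemma smooth_hor (w : TV R n -> 'rV[R]_n) : smooth_on A w ->
  smooth_on A (fun z => hor (w z)).
Proof. exact: smooth_linf_comp oA linf_hor (@continuous_inl _ _ _). Qed.

Lemma dirD_vert (w : TV R n -> 'rV[R]_n) v z : smooth_on A w -> A z ->
  'd_v (fun y => vert (w y)) z = vert ('d_v w z).
Proof.
move=> smw Az.
exact: dirD_linf_comp v linf_vert continuous_vert smw Az.
Qed.

Section Degree.
Context {W : normedModType R} {fW : findim W}.
Implicit Types (f g : TV R n -> W) (k l : R).

(** Homogeneity of degree k in the fibre variable, as Euler's identity. This
    form makes sense on any open set and passes to derivatives. *)
Definition homog k f := forall z, A z -> 'd_(liouville z) f z = k *: f z.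

Lemma homog_ext k f g : (forall z, A z -> f z = g z) -> homog k f -> homog k g.
Proof. by move=> fg hf z Az; rewrite -(dirD_ext _ oA Az fg) hf// fg. Qed.

Lemma homog_eq k l f : k = l -> homog k f -> homog l f.
Proof. by move=> ->. Qed.

(** Euler's identity differentiated along a; the correction term is the
    derivative of the Liouville field along a. *)
Lemma homog_dirD k f a z : smooth_on A f -> homog k f -> A z ->
  'd_(liouville z) (fun y => 'd_a f y) z = k *: 'd_a f z - 'd_(vert a.2) f z.
Proof.
move=> smf hf Az; rewrite (dirD_schwarz oA _ _ smf Az).
have e1 := dirD_ext (f := fun y => 'd_(liouville y) f y) (g := fun y => k *: f y)
  a oA Az hf.
have := etrans (esym e1) (dirD_dirD_along oA smf smooth_liouville a Az).
by rewrite dirD_liouville (dirDZ _ _ smf Az) => ->; rewrite addrK.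
Qed.

Lemma homog_dirD_vert k f b : smooth_on A f -> homog k f ->
  homog (k - 1) (fun y => 'd_(vert b) f y).
Proof.
by move=> smf hf z Az; rewrite (homog_dirD _ smf hf Az) scalerBl scale1r.
Qed.

Lemma homog_dirD_hor k f a : smooth_on A f -> homog k f ->
  homog k (fun y => 'd_(hor a) f y).
Proof.
by move=> smf hf z Az; rewrite (homog_dirD _ smf hf Az) vert0 dirD0 subr0.
Qed.

Lemma homog_cst (c : W) : homog 0 (fun _ => c).
Proof. by move=> z Az; rewrite scale0r; exact: dirD_cst. Qed.

Lemma homogD k f g : smooth_on A f -> smooth_on A g -> homog k f -> homog k g ->
  homog k (fun z => f z + g z).
Proof.
by move=> smf smg hf hg z Az; rewrite (dirDD _ smf smg Az) hf// hg// scalerDr.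
Qed.

Lemma homogB k f g : smooth_on A f -> smooth_on A g -> homog k f -> homog k g ->
  homog k (fun z => f z - g z).
Proof.
by move=> smf smg hf hg z Az; rewrite (dirDB _ smf smg Az) hf// hg// scalerBr.
Qed.

Lemma homogZ k c f : smooth_on A f -> homog k f -> homog k (fun z => c *: f z).
Proof.
by move=> smf hf z Az; rewrite (dirDZ _ _ smf Az) hf// !scalerA mulrC.
Qed.

End Degree.

(** The degrees of the two arguments of an evaluation add up, by the Leibniz
    rule. *)
Lemma homog_linfam (V W : normedModType R) {fV : findim V} {fW : findim W} k l
    (L : TV R n -> V -> W) (w : TV R n -> V) : linfam A L -> smooth_on A w ->
  (forall a, homog k (fun z => L z a)) -> homog l w ->
  homog (k + l) (fun z => L z (w z)).
Proof.
move=> famL smw hL hw z Az; pose proof (dirD_linfam oA famL smw (liouville z) Az) as e.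
rewrite e (hw z Az) (linfZ (famL.1 z Az)) scalerDl.
by congr (_ + _); exact: (hL (w z) z Az).
Qed.

Section DegreeAlong.
Context {W : normedModType R} {fW : findim W}.

Lemma homog_dirD_along_vert k l (f : TV R n -> W) (w : TV R n -> 'rV[R]_n) :
  smooth_on A f -> smooth_on A w -> homog k f -> homog l w ->
  homog (k - 1 + l) (fun y => 'd_(vert (w y)) f y).
Proof.
move=> smf smw hf hw z Az.
have smvw : smooth_on A (fun y => vert (w y)).
  by apply: smooth_linf_comp smw => //; [exact: linf_vert|exact: continuous_vert].
rewrite (dirD_dirD_along oA smf smvw (liouville z) Az).
rewrite (homog_dirD (vert (w z)) smf hf Az).
have -> := dirD_linf_comp (liouville z) linf_vert continuous_vert smw Az.
have lf : is_linear (fun v => 'd_v f z) by exact (dirD_linf oA smf Az).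
by rewrite (hw z Az) (linfZ linf_vert) (linfZ lf) scalerDl scalerBl scale1r.
Qed.

End DegreeAlong.

End Homogeneity.

(** * The form Omega and Lie brackets in a chart *)

Lemma lie0E (R : realType) n (X : vf R n) (f : sf R n) :
  lie0 X f = fun z => 'd_(X z) f z.
Proof. by apply: funext => z; rewrite dirDE. Qed.

Lemma bracketE (R : realType) n (X Y : vf R n) :
  bracket X Y = fun z => 'd_(X z) Y z - 'd_(Y z) X z.
Proof. by apply: funext => z; rewrite !dirDE. Qed.

Lemma bracket_cst (R : realType) n (a b : TV R n) :
  bracket (fun _ => a) (fun _ => b) = (fun _ => 0) :> vf R n.
Proof. by rewrite bracketE; apply: funext => z; rewrite !dirD_cst subr0. Qed.

Lemma cancel_along (V : zmodType) (p q u v : V) : p + u - (q + v) - (u - v) = p - q.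
Proof. by rewrite opprD addrACA addrK. Qed.

Section Energy.
Context {R : realType} {n : nat}.
Variables (A : set (TV R n)).
Hypothesis oA : open A.

Definition hess (f : TV R n -> R) (a b z : TV R n) : R :=
  'd_a (fun y => 'd_b f y) z.

Section Hessian.
Variable f : TV R n -> R.
Hypothesis smf : smooth_on A f.

Lemma hessC a b z : A z -> hess f a b z = hess f b a z.
Proof. by move=> Az; rewrite /hess; apply (dirD_schwarz oA _ _ smf Az). Qed.

Lemma linf_hessl b z : A z -> is_linear (fun a => hess f a b z : R).
Proof. by move=> Az; exact (dirD_linf oA (smooth_dirD b smf) Az). Qed.

Lemma linf_hessr a z : A z -> is_linear (fun b => hess f a b z : R).
Proof.
by move=> Az c b b'; rewrite !(hessC a)//; exact: linf_hessl.
Qed.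

Lemma smooth_hess a b : smooth_on A (fun z => hess f a b z : R).
Proof. by apply: smooth_dirD; exact: smooth_dirD. Qed.

Lemma smooth_J (X : vf R n) : smooth_on A X -> smooth_on A (J X).
Proof.
apply: smooth_linf_comp => //; first exact: linf_tangentJ.
by apply linf_continuous; exact: linf_tangentJ.
Qed.

Lemma dirD_J (X : vf R n) z v : smooth_on A X -> A z ->
  'd_v (J X) z = tangentJ ('d_v X z).
Proof.
move=> smX Az; apply: (dirD_linf_comp (L := @tangentJ R n)) smX Az.
  exact: linf_tangentJ.
by apply linf_continuous; exact: linf_tangentJ.
Qed.

(** The derivatives of the fields X and Y cancel against the term of the
    bracket [X, Y]. *)
Lemma OmegaE X Y z : smooth_on A X -> smooth_on A Y -> A z ->
  Omega f X Y z = hess f (X z) (tangentJ (Y z)) z - hess f (Y z) (tangentJ (X z)) z.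
Proof.
move=> smX smY Az.
have lf : is_linear (fun v => 'd_v f z : R) by exact (dirD_linf oA smf Az).
have eXY V W' : smooth_on A V -> smooth_on A W' ->
    lie0 V (dJ f W') z = hess f (V z) (J W' z) z + 'd_(tangentJ ('d_(V z) W' z)) f z.
  move=> smV smW; rewrite -(dirD_J (V z) smW Az) /dJ /d !lie0E.
  exact: (dirD_dirD_along oA smf (smooth_J smW) (V z) Az).
rewrite /Omega /extd (eXY X Y smX smY) (eXY Y X smY smX).
rewrite /dJ /d lie0E bracketE /J (linfB linf_tangentJ) (linfB lf).
exact: cancel_along.
Qed.

End Hessian.

End Energy.

Lemma smooth_bracket (R : realType) n (A : set (TV R n)) (X Y : vf R n) : open A ->
  smooth_on A X -> smooth_on A Y -> smooth_on A (bracket X Y).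
Proof.
move=> oA smX smY; rewrite bracketE; apply: (smoothB oA).
  exact: (smooth_dirD_along oA smY smX).
exact: (smooth_dirD_along oA smX smY).
Qed.
Lemma bracket_ext (R : realType) n (A : set (TV R n)) (X X' Y Y' : vf R n) z :
  open A -> A z -> (forall y, A y -> X y = X' y) ->
  (forall y, A y -> Y y = Y' y) -> bracket X Y z = bracket X' Y' z.
Proof.
move=> oA Az eX eY; rewrite !bracketE (eX z Az) (eY z Az).
by rewrite (dirD_ext _ oA Az eX) (dirD_ext _ oA Az eY).
Qed.

(** * The geodesic equation *)

(** A Finsler energy and its canonical spray in one chart; A stands for the
    domain of the chart without the zero section. *)
Record finsler_spray (R : realType) (n : nat) (A : set (TV R n)) (E : sf R n)
    (S : vf R n) : Prop := FinslerSpray {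
  fs_open : open A;
  fs_energy : smooth_on A E;
  fs_spray : smooth_on A S;
  fs_homog : homog A 2 (E : TV R n -> R);
  fs_rank : forall z, A z -> \rank (gram (Omega E) z) = (n + n)%N;
  fs_eq : forall X, smooth_on A X -> forall z, A z -> Omega E S X z = - d E X z }.

Section Spray.
Context {R : realType} {n : nat} {A : set (TV R n)} {E : sf R n} {S : vf R n}.
Hypothesis fS : finsler_spray A E S.

Let oA := fs_open fS.
Let smE := fs_energy fS.
Let smS := fs_spray fS.
Let homE := fs_homog fS.

Local Notation H := (hess E).

Lemma hess0r a z : A z -> H a 0 z = 0.
Proof. by move=> Az; exact: linf0 (linf_hessr oA smE a Az). Qed.

Lemma hess0l a z : A z -> H 0 a z = 0.
Proof. by move=> Az; exact: linf0 (linf_hessl oA smE a Az). Qed.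

Lemma Omega_cst a b z : A z ->
  Omega E (fun _ => a) (fun _ => b) z = H a (tangentJ b) z - H b (tangentJ a) z.
Proof. by move=> Az; rewrite (OmegaE oA smE (smooth_cst A a) (smooth_cst A b) Az). Qed.

(** Paired with a vertical vector, Omega only involves the vertical Hessian,
    so a vertical vector in the kernel of the Hessian is in the kernel of
    Omega. *)
Lemma fund_nondeg z w : A z -> (forall b, H (vert w) (vert b) z = 0) -> w = 0.
Proof.
move=> Az Hw.
pose r : 'rV[R]_(n + n) := row_mx 0 w.
pose fr (k : 'I_(n + n)) : TV R n := frame k z.
have frE k u : frame k u = fr k by [].
have rfr : \sum_k r 0 k *: fr k = vert w.
  rewrite big_split_ord /= big1 ?add0r => [|k _]; last first.
    by rewrite /r row_mxEl mxE scale0r.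
  rewrite [in RHS](row_sum_delta w) (linf_sum (@linf_vert R n)).
  apply: eq_bigr => k _; rewrite /r row_mxEr (linfZ (@linf_vert R n)).
  by rewrite /fr /frame; case: split_ordP => j /eqP; rewrite ?eq_rlshift// eq_rshift => /eqP <-.
have rgram : r *m gram (Omega E) z = 0.
  apply/rowP => l; rewrite !mxE.
  pose phi (a : TV R n) : R := H a (tangentJ (fr l)) z - H (fr l) (tangentJ a) z.
  have lphi : is_linear phi.
    apply: (linf_sub (f := fun a => H a (tangentJ (fr l)) z)
      (g := fun a => H (fr l) (tangentJ a) z)); first exact (linf_hessl oA smE _ Az).
    apply: (linf_comp (f := fun a => H (fr l) a z)); first exact (linf_hessr oA smE _ Az).
    exact: linf_tangentJ.
  have -> : \sum_j r 0 j * gram (Omega E) z j l = phi (vert w).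
    rewrite -rfr (linf_sum lphi); apply: eq_bigr => k _.
    rewrite (linfZ lphi) [gram _ _ _ _]mxE; congr (_ * _).
    exact: (Omega_cst (fr k) (fr l) Az).
  rewrite /phi (_ : tangentJ (vert w) = 0)// hess0r// subr0.
  exact: Hw.
have ug : gram (Omega E) z \in unitmx.
  by rewrite -row_free_unit /row_free (fs_rank fS Az).
have r0 : r = 0 by rewrite -[r](mulmxK ug) rgram mul0mx.
by have := congr1 rsubmx r0; rewrite /r row_mxKr => ->; apply/rowP => j; rewrite !mxE.
Qed.

(** Nondegeneracy as a tool: a vector is determined by its base component and
    its Hessian pairings with vertical vectors. *)
Lemma fund_inj z (a b : TV R n) : A z -> a.1 = b.1 ->
  (forall d, H a (vert d) z = H b (vert d) z) -> a = b.
Proof.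
move=> Az ab1 Hab; apply/eqP; rewrite -subr_eq0; apply/eqP.
have v1 : (a - b).1 = 0 by rewrite /= ab1 subrr.
rewrite (TV_vert v1); suff -> : (a - b).2 = 0 by [].
apply: (fund_nondeg Az) => b'; rewrite -(TV_vert v1).
by rewrite (linfB (linf_hessl oA smE (vert b') Az)) Hab subrr.
Qed.

Lemma hess_liouville a z : A z ->
  H (liouville z) a z = 2 * 'd_a E z - 'd_(vert a.2) E z.
Proof. by move=> Az; exact (homog_dirD oA a smE homE Az). Qed.

(** The spray equation tested on vertical vectors, compared with Euler's
    identity for the vertical derivatives of E. *)
Lemma spray_base z : A z -> (S z).1 = z.2.
Proof.
move=> Az; suff : vert (S z).1 = liouville z by case.
apply: (fund_inj Az) => [|b]; first by [].
have := fs_eq fS (smooth_cst A (vert b)) Az.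
rewrite (OmegaE oA smE smS (smooth_cst A (vert b)) Az).
rewrite [tangentJ (vert b)]/(0 : TV R n) (hess0r _ Az) sub0r => /oppr_inj.
rewrite (hessC oA smE _ _ Az) => ->.
by rewrite (hess_liouville _ Az) /d lie0E mulr2n mulrDl mul1r addrK.
Qed.

(** The spray equation tested on horizontal coordinate vectors: the geodesic
    equation. *)
Lemma spray_hess b z : A z -> H (S z) (vert b) z = 'd_(hor b) E z.
Proof.
move=> Az; have := fs_eq fS (smooth_cst A (hor b)) Az.
rewrite (OmegaE oA smE smS (smooth_cst A (hor b)) Az).
rewrite [tangentJ (hor b)]/(vert b) /tangentJ (spray_base Az) -[(0, z.2)]/(liouville z).
rewrite [X in _ - X](hessC oA smE _ _ Az) (hess_liouville _ Az).
rewrite vert0 dirD0 subr0 /d lie0E => /(canRL (subrK _)) ->.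
by rewrite mulr2n mulrDl mul1r addKr.
Qed.

Lemma dirD_S a z : A z -> 'd_a S z = (a.2, 'd_a (fun y => (S y).2) z).
Proof.
move=> Az; rewrite [LHS]surjective_pairing -(dirD_fst a smS Az).
rewrite -(dirD_snd a smS Az); congr (_, _).
have -> := dirD_ext (f := fun y => (S y).1) (g := snd) a oA Az (@spray_base).
by apply: dirD_linf_map; [exact: linf_snd|exact: continuous_snd].
Qed.

(** Both sides of the geodesic equation are differentiated along the Liouville
    field; the degrees of the derivatives of E are known, and nondegeneracy
    gives the degree of S. *)
Lemma homog_S2 : homog A 2 (fun z => (S z).2).
Proof.
move=> z Az.
(* the claim is the fibre component of [C, S] = S *)
suff : 'd_(liouville z) S z = hor z.2 + vert (2 *: (S z).2).
  by rewrite (dirD_S _ Az) => e; have := congr1 snd e; rewrite /= add0r.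
apply: (fund_inj Az) => [|b]; first by rewrite (dirD_S _ Az) /= addr0.
have he : homog A 1 (fun y => 'd_(vert b) E y : R).
  apply: (homog_eq _ (homog_dirD_vert oA b smE homE)); ring.
have sme := smooth_dirD (vert b) smE.
pose proof (dirD_dirD_along oA sme smS (liouville z) Az) as e1.
have e2 := dirD_ext (f := fun y => 'd_(S y) (fun x => 'd_(vert b) E x) y)
   (g := fun y => 'd_(hor b) E y) (liouville z) oA Az (fun y Ay => spray_hess b Ay).
move: (etrans (esym e1) e2).
pose proof (homog_dirD oA (S z) sme he Az) as e3.
pose proof (homog_dirD_hor oA b smE homE Az) as e4.
rewrite e3 e4 -(spray_hess b Az) scale1r => {e1 e2 e3 e4}.
rewrite -!/(H _ _ z).
have lH := linf_hessl oA smE (vert b) Az.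
have -> : hor z.2 + vert (2 *: (S z).2) = S z + vert (S z).2.
  rewrite {2}(horDvert (S z)) (spray_base Az) (linfZ (@linf_vert R n)) -addrA.
  by rewrite scaler_nat mulr2n.
rewrite (linfD lH) => /(canRL (addKr _)) ->.
by rewrite opprB scaler_nat mulr2n addrA subrK addrC.
Qed.

End Spray.

(** * The Barthel connection *)

Lemma scale_half_double (R : realType) (V : lmodType R) (v : V) : 2^-1 *: (v + v) = v.
Proof.
by rewrite scalerDr -scalerDl (_ : 2^-1 + 2^-1 = 1 :> R) ?scale1r//; lra.
Qed.

Lemma bracket_cancel (V : zmodType) (a b c e p q r s : V) :
  a = p - q -> b = r - q -> c = p - s -> e = r - s -> a - b - c = - e.
Proof.
move=> -> -> -> ->.
by rewrite !opprB !addrA subrK addrAC (addrAC p) subrr add0r addrC.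
Qed.

Section Barthel.
Context {R : realType} {n : nat} {A : set (TV R n)} {E : sf R n} {S : vf R n}.
Hypothesis fS : finsler_spray A E S.

Let oA := fs_open fS.
Let smE := fs_energy fS.
Let smS := fs_spray fS.

Local Notation H := (hess E).
Local Notation S2 := (fun y => (S y).2).

Let smS2 : smooth_on A S2 := smooth_snd oA smS.

(** Minus the usual coefficients of the Barthel connection, so that the
    horizontal lift of a is (a, nlc z a). *)
Definition nlc (z : TV R n) (a : 'rV[R]_n) : 'rV[R]_n := 2^-1 *: 'd_(vert a) S2 z.
Definition hlift (z : TV R n) (a : 'rV[R]_n) : TV R n := (a, nlc z a).

Lemma linf_nlc z : A z -> is_linear (nlc z).
Proof.
move=> Az; apply: (linf_comp (f := fun u => 2^-1 *: u)).
  by move=> c u v; rewrite scalerDr !scalerA mulrC.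
apply: (linf_comp (f := fun v => 'd_v S2 z)); last exact: linf_vert.
exact (dirD_linf oA smS2 Az).
Qed.

Lemma linf_hlift z : A z -> is_linear (hlift z).
Proof. by move=> Az c a b; rewrite /hlift (linf_nlc Az). Qed.

Lemma smooth_nlc a : smooth_on A (fun z => nlc z a).
Proof. by apply: smoothZ_cst oA _; exact: smooth_dirD. Qed.

Lemma smooth_hlift a : smooth_on A (fun z => hlift z a).
Proof. exact: (smooth_pair oA (smooth_cst A a) (smooth_nlc a)). Qed.

Lemma linfam_hlift : linfam A hlift.
Proof. by split=> [z|a]; [exact: linf_hlift|exact: smooth_hlift]. Qed.

Lemma homog_nlc a : homog A 1 (fun z => nlc z a).
Proof.
apply: homogZ; first exact: smooth_dirD.
apply: (homog_eq _ (homog_dirD_vert oA a smS2 (homog_S2 fS))); ring.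
Qed.

Lemma dirD_hlift v a z : A z ->
  'd_v (fun y => hlift y a) z = vert ('d_v (fun y => nlc y a) z).
Proof.
move=> Az; rewrite (dirD_pair oA v (smooth_cst A a) (smooth_nlc a) Az).
by rewrite dirD_cst.
Qed.

Lemma barthelE X z : smooth_on A X -> A z ->
  barthel S X z = ((X z).1, 'd_(vert (X z).1) S2 z - (X z).2).
Proof.
move=> smX Az; rewrite /barthel !bracketE (dirD_J (S z) smX Az) /J.
rewrite !(dirD_S fS _ Az) (linfB linf_tangentJ) opprB addrA subrK.
by congr (_, _); rewrite /= subr0.
Qed.

Lemma hprojE X z : smooth_on A X -> A z -> hproj S X z = hlift z (X z).1.
Proof.
move=> smX Az; rewrite /hproj (barthelE smX Az) /hlift /nlc.
congr (_, _) => /=; last by rewrite addrC subrK.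
exact: scale_half_double.
Qed.

Lemma vprojE X z : smooth_on A X -> A z ->
  vproj S X z = vert ((X z).2 - nlc z (X z).1).
Proof.
move=> smX Az; rewrite /vproj (barthelE smX Az) /nlc.
congr (_, _) => /=; first by rewrite subrr scaler0.
by rewrite opprB addrA scalerBr scale_half_double.
Qed.

Lemma smooth_hproj X : smooth_on A X -> smooth_on A (hproj S X).
Proof.
move=> smX; apply: (smooth_ext (f := fun z => hlift z (X z).1)) oA _ _.
  by move=> z Az; rewrite (hprojE smX Az).
exact: (smooth_linfam oA linfam_hlift (smooth_fst oA smX)).
Qed.

(** The geodesic equation in the direction of the Liouville field, compared
    with Euler's identity. *)
Lemma energy_spray z : A z -> 'd_(S z) E z = 0.
Proof.
move=> Az.
(* with p and q the derivatives of E along y d/dx and the vertical part of S: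
   2 (p + q) - q = p, so S(E) = p + q = 0 *)
have e1 : H (S z) (liouville z) z = 'd_(hor z.2) E z := spray_hess fS z.2 Az.
have e2 := hess_liouville fS (S z) Az.
have lE : is_linear (fun v => 'd_v E z : R) by exact (dirD_linf oA smE Az).
have e3 : 'd_(S z) E z = 'd_(hor z.2) E z + 'd_(vert (S z).2) E z.
  by rewrite {1}(horDvert (S z)) (linfD lE) (spray_base fS Az).
move: e1; rewrite (hessC oA smE _ _ Az) e2 e3.
set p := 'd_(hor _) E z; set q := 'd_(vert _) E z => e; lra.
Qed.

(** This is d_h E = 0: by the geodesic equation, the vertical derivative of
    S(E) = 0 along a is twice the derivative of E along the lift of a. *)
Lemma energy_hlift z a : A z -> 'd_(hlift z a) E z = 0.
Proof.
move=> Az; have lE : is_linear (fun v => 'd_v E z : R) by exact (dirD_linf oA smE Az).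
pose proof (dirD_dirD_along oA smE smS (vert a) Az) as e1.
have e2 : 'd_(vert a) (fun y => 'd_(S y) E y) z = 0.
  by rewrite (dirD_ext (g := fun _ => 0) _ oA Az energy_spray) dirD_cst.
have e3 : 'd_(vert a) (fun y => 'd_(S z) E y) z = 'd_(hor a) E z.
  by rewrite -(spray_hess fS a Az) (hessC oA smE _ _ Az).
have e4 : 'd_(vert a) S z = hlift z a + hlift z a - hor a.
  rewrite (dirD_S fS _ Az) /hlift /nlc /=; congr (_, _) => /=; first by rewrite addrK.
  by rewrite subr0 -scalerDr scale_half_double.
move: e1; rewrite e2 e3 e4 (linfB lE) (linfD lE).
by set p := 'd_(hor _) E z; set q := 'd_(hlift _ _) E z => e; lra.
Qed.

Lemma dirD_hproj X v z : smooth_on A X -> A z ->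
  'd_v (hproj S X) z = 'd_v (fun y => hlift y (X y).1) z.
Proof.
by move=> smX Az; apply: (dirD_ext v oA Az) => y Ay; rewrite (hprojE smX Ay).
Qed.

(** Minus the coefficients of the Berwald connection. *)
Definition nlc2 (z : TV R n) (a b : 'rV[R]_n) : 'rV[R]_n :=
  'd_(vert b) (fun y => nlc y a) z.

Lemma nlc2C z a b : A z -> nlc2 z a b = nlc2 z b a.
Proof.
move=> Az; rewrite /nlc2 /nlc.
rewrite (dirDZ _ _ (smooth_dirD _ smS2) Az) (dirDZ _ _ (smooth_dirD _ smS2) Az).
by congr (_ *: _); apply (dirD_schwarz oA _ _ smS2 Az).
Qed.

Lemma smooth_nlc2 a b : smooth_on A (fun z => nlc2 z a b).
Proof. exact: smooth_dirD (smooth_nlc a). Qed.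

Lemma homog_nlc2 a b : homog A 0 (fun z => nlc2 z a b).
Proof.
apply: (homog_eq _ (homog_dirD_vert oA b (smooth_nlc a) (homog_nlc a))); ring.
Qed.

(** The Liouville field commutes with the horizontal lift of a constant
    vector, because nlc has degree 1. *)
Lemma homog_dirD_hlift (W : normedModType R) {fW : findim W} k a (f : TV R n -> W) :
  smooth_on A f -> homog A k f -> homog A k (fun y => 'd_(hlift y a) f y).
Proof.
move=> smf hf z Az.
pose proof (dirD_dirD_along oA smf (smooth_hlift a) (liouville z) Az) as e1.
pose proof (homog_dirD oA (hlift z a) smf hf Az) as e2.
rewrite e1 e2 (dirD_hlift _ _ Az) (homog_nlc a Az) scale1r /=.
by rewrite subrK.
Qed.

(** Horizontal projections only depend on base components, so the projected
    terms of the bracket [h, h] add up to minus the horizontal part of the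
    first two terms. *)
Lemma fn_bracket_cancel (B0 B1 B2 B : vf R n) z :
  smooth_on A B0 -> smooth_on A B1 -> smooth_on A B2 -> smooth_on A B -> A z ->
  (B0 z).1 - (B1 z).1 - (B2 z).1 = - (B z).1 ->
  - (2^-1 *: (B z + B z + hproj S (hproj S B0) z + hproj S (hproj S B0) z
      - hproj S B1 z - hproj S B2 z - hproj S B1 z - hproj S B2 z))
  = - vproj S B z.
Proof.
move=> sm0 sm1 sm2 sm Az e.
have lh := linf_hlift Az.
rewrite (hprojE (smooth_hproj sm0) Az) (hprojE sm0 Az) [(hlift z _).1]/=.
rewrite (hprojE sm1 Az) (hprojE sm2 Az) (vprojE sm Az).
have -> : vert ((B z).2 - nlc z (B z).1) = B z - hlift z (B z).1.
  by rewrite {3}(surjective_pairing (B z)); congr (_, _); rewrite /= subrr.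
have e3 : hlift z (B0 z).1 - hlift z (B1 z).1 - hlift z (B2 z).1 = - hlift z (B z).1.
  by rewrite -!(linfB lh) e (linfN lh).
rewrite -e3.
move: (hlift z (B0 z).1) (hlift z (B1 z).1) (hlift z (B2 z).1) (B z) => p q r b.
by rewrite -[in RHS](scale_half_double (b + (p - q - r))); congr (- (_ *: _));
  apply fd_inj => k; rewrite !fd_crdE; ring.
Qed.

(** The hypothesis of [fn_bracket_cancel] holds for brackets of X, hX with Y,
    hY because a field and its horizontal projection have the same base
    component. *)
Lemma barthel_curvE X Y z : smooth_on A X -> smooth_on A Y -> A z ->
  barthel_curv S X Y z = - vproj S (bracket (hproj S X) (hproj S Y)) z.
Proof.
move=> smX smY Az.
have smhX := smooth_hproj smX; have smhY := smooth_hproj smY.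
have base V v : smooth_on A V -> ('d_v (hproj S V) z).1 = ('d_v V z).1.
  move=> smV; rewrite -(dirD_fst _ (smooth_hproj smV) Az) -(dirD_fst _ smV Az).
  by apply: (dirD_ext v oA Az) => y Ay; rewrite (hprojE smV Ay).
apply: (fn_bracket_cancel (smooth_bracket oA smX smY) (smooth_bracket oA smhX smY)
  (smooth_bracket oA smX smhY) (smooth_bracket oA smhX smhY) Az).
have e V W : (bracket V W z).1 = ('d_(V z) W z).1 - ('d_(W z) V z).1.
  by rewrite bracketE.
apply: (bracket_cancel (e X Y) (etrans (e _ _) _) (etrans (e _ _) _) (etrans (e _ _) _)).
- by rewrite (base X (Y z) smX).
- by rewrite (base Y (X z) smY).
exact: (congr2 (fun u v => u - v) (base Y (hproj S X z) smY) (base X (hproj S Y z) smX)).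
Qed.

End Barthel.

Arguments nlc {R n} S z a.
Arguments hlift {R n} S z a.
Arguments nlc2 {R n} S z a b.

(** * The Cartan tensors *)

Section Semibasic.
Context {R : realType} {n : nat} (A : set (TV R n)).
Hypothesis oA : open A.

Record semibasic (T : TV R n -> TV R n -> TV R n -> TV R n) : Prop := Semibasic {
  sb_linf : forall z a, A z -> is_linear (T z a);
  sb_smooth : forall a b, smooth_on A (fun z => T z a b);
  sb_sym : forall z a b, A z -> T z a b = T z b a;
  sb_J : forall z a b, A z -> T z (tangentJ a) b = 0;
  sb_vert : forall z a b, A z -> (T z a b).1 = 0 }.

Variable T : TV R n -> TV R n -> TV R n -> TV R n.
Hypothesis sT : semibasic T.

Lemma semibasic_base z a b : A z -> T z a b = T z (hor a.1) (hor b.1).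
Proof.
have half u v : A z -> T z u v = T z u (hor v.1).
  move=> Az; rewrite {1}(horDvert v) (linfD (sb_linf sT u Az)).
  by rewrite (sb_sym sT u (vert _) Az) (sb_J sT (hor v.2) u Az) addr0.
by move=> Az; rewrite (half _ _ Az) (sb_sym sT _ _ Az) (half _ _ Az) (sb_sym sT _ _ Az).
Qed.

Lemma linfam_semibasic a : linfam A (fun z b => T z a b).
Proof. by split=> [z Az|b]; [exact: (sb_linf sT a Az)|exact: (sb_smooth sT a b)]. Qed.

End Semibasic.

Section Tensors.
Context {R : realType} {n : nat} {A : set (TV R n)} {E : sf R n} {S : vf R n}.
Variable F : TV R n -> TV R n -> TV R n.

Record complex_on : Prop := ComplexOn {
  cx_linfam : linfam A F;
  cx_J : forall X, smooth_on A X -> forall z, A z -> app1 F (J X) z = hproj S X z }.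

Hypothesis fS : finsler_spray A E S.
Hypothesis cF : complex_on.

Let oA := fs_open fS.
Let smE := fs_energy fS.
Let homE := fs_homog fS.

Local Notation H := (hess E).

Lemma cx_vert z b : A z -> F z (vert b) = hlift S z b.
Proof.
move=> Az; have := cx_J cF (smooth_cst A (hor b)) Az.
by rewrite (hprojE fS (smooth_cst A (hor b)) Az).
Qed.

Lemma smooth_app1 X : smooth_on A X -> smooth_on A (app1 F X).
Proof. by move=> smX; exact: (smooth_linfam oA (cx_linfam cF) smX). Qed.

Lemma metricE Y Z z : smooth_on A Y -> smooth_on A Z -> A z ->
  metric E F Y Z z = H (Y z) (tangentJ (F z (Z z))) z - H (F z (Z z)) (tangentJ (Y z)) z.
Proof.
by move=> smY smZ Az; rewrite /metric (OmegaE oA smE smY (smooth_app1 smZ) Az).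
Qed.

(** F maps a vertical vector to the horizontal lift of its component. *)
Lemma metric_vert Y Z z : smooth_on A Y -> smooth_on A Z -> A z ->
  (Y z).1 = 0 -> (Z z).1 = 0 -> metric E F Y Z z = H (Y z) (Z z) z.
Proof.
move=> smY smZ Az Y0 Z0; rewrite (metricE smY smZ Az).
rewrite (TV_vert Z0) (cx_vert _ Az) (TV_vert Y0).
by rewrite [tangentJ (vert _)]/(0 : TV R n) (hess0r fS _ Az) subr0.
Qed.

Lemma Omega_vert X d z : smooth_on A X -> A z -> (X z).1 = 0 ->
  Omega E X (fun _ => d) z = H (X z) (vert d.1) z.
Proof.
move=> smX Az X0; rewrite (OmegaE oA smE smX (smooth_cst A d) Az).
rewrite (TV_vert X0) [tangentJ (vert _)]/(0 : TV R n) (hess0r fS _ Az) subr0.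
by [].
Qed.

Lemma metric0l Y z : smooth_on A Y -> A z -> (Y z).1 = 0 ->
  metric E F (fun _ => 0) Y z = 0.
Proof.
move=> smY Az Y0; rewrite (metric_vert (smooth_cst A 0) smY Az erefl Y0).
exact: (hess0l fS _ Az).
Qed.

Lemma metric0r Y z : smooth_on A Y -> A z -> (Y z).1 = 0 ->
  metric E F Y (fun _ => 0) z = 0.
Proof.
move=> smY Az Y0; rewrite (metric_vert smY (smooth_cst A 0) Az Y0 erefl).
exact: (hess0r fS _ Az).
Qed.

Lemma homog_energy_vert d : homog A 1 (fun y => 'd_(vert d) E y : R).
Proof. by apply: (homog_eq _ (homog_dirD_vert oA d smE homE)); ring. Qed.

(** The fundamental tensor has degree 0, so a vertical field inherits its
    degree from its pairings with constant vertical vectors. *)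
Lemma homog_of_hess k (T : vf R n) : smooth_on A T ->
  (forall z, A z -> (T z).1 = 0) ->
  (forall d, homog A k (fun z => H (T z) (vert d) z : R)) -> homog A k T.
Proof.
move=> smT vT hT z Az.
have d1 : ('d_(liouville z) T z).1 = 0.
  rewrite -(dirD_fst _ smT Az) (dirD_ext (g := fun _ => 0) _ oA Az vT).
  exact: dirD_cst.
apply: (fund_inj fS Az) => [|d]; first by rewrite d1 /= (vT z Az) scaler0.
have he := homog_energy_vert d; have sme := smooth_dirD (vert d) smE.
pose proof (dirD_dirD_along oA sme smT (liouville z) Az) as e2.
pose proof (homog_dirD oA (T z) sme he Az) as e3.
move: e2; rewrite (hT d z Az) e3 -(TV_vert (vT z Az)) scale1r subrr add0r => e6.
rewrite (linfZ (linf_hessl oA smE (vert d) Az)).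
exact: esym e6.
Qed.

Section First.
Variable C : TV R n -> TV R n -> TV R n -> TV R n.
Hypothesis sC : semibasic A C.
Hypothesis C_eq : forall X Y Z, smooth_on A X -> smooth_on A Y -> smooth_on A Z ->
  forall z, A z -> Omega E (app2 C X Y) Z z
    = 2%:R^-1 * lie2 (J X) (pullJ (metric E F)) Y Z z.

(** On constant fields all brackets vanish, and the Lie derivative of J^* g is
    the derivative of the fundamental tensor. *)
Lemma first_cartanE z a b d : A z ->
  H (C z a b) (vert d) z
  = 2^-1 * 'd_(vert a.1) (fun y => H (vert b.1) (vert d) y) z.
Proof.
move=> Az.
have smc u : smooth_on A (fun _ => u : TV R n) by exact: smooth_cst.
have := C_eq (smc a) (smc b) (smc (hor d)) Az.
rewrite (Omega_vert (hor d) (sb_smooth sC a b) Az (sb_vert sC a b Az)).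
rewrite /lie2 -[J (fun _ => a)]/(fun _ => tangentJ a) !bracket_cst.
rewrite /pullJ -[J (fun _ => 0)]/(fun _ => 0 : TV R n).
rewrite (metric0l (smooth_J oA (smc (hor d))) Az erefl).
rewrite (metric0r (smooth_J oA (smc b)) Az erefl) !subr0 lie0E.
have e y : A y -> metric E F (J (fun _ => b)) (J (fun _ => hor d)) y
    = H (vert b.1) (vert d) y.
  by move=> Ay; exact: (metric_vert (smc (vert b.1)) (smc (vert d)) Ay erefl erefl).
by rewrite (dirD_ext _ oA Az e).
Qed.

(** The vertical derivative of a function of degree 1 has degree 0, so it is
    constant in the direction of the Liouville field. *)
Lemma first_cartan_liouville z a b : A z -> b.1 = z.2 -> C z a b = 0.
Proof.
move=> Az bz; apply: (fund_inj fS Az) => [|d]; first by rewrite (sb_vert sC _ _ Az).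
rewrite (first_cartanE _ _ _ Az) (hess0l fS _ Az) bz.
have he := homog_energy_vert d; have sme := smooth_dirD (vert d) smE.
set e1 := fun x => 'd_(vert d) E x.
rewrite -[X in 'd_(vert a.1) X z]/(fun y => 'd_(vert z.2) e1 y).
rewrite (dirD_schwarz oA _ _ sme Az) -liouville_vert.
pose proof (homog_dirD_vert oA a.1 sme he) as h0; rewrite (h0 z Az) subrr scale0r.
by rewrite mulr0.
Qed.

Lemma homog_first_cartan a b : homog A (-1) (fun z => C z a b).
Proof.
apply: (homog_of_hess (sb_smooth sC a b) (fun z Az => sb_vert sC a b Az)) => d.
have he := homog_energy_vert d; have sme := smooth_dirD (vert d) smE.
pose proof (homog_dirD_vert oA b.1 sme he) as hb.
pose proof (homog_dirD_vert oA a.1 (smooth_dirD (vert b.1) sme) hb) as hab.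
apply: (homog_ext oA (f := fun z => 2^-1 *: 'd_(vert a.1) (fun y =>
    H (vert b.1) (vert d) y) z)) => [z Az|]; first by rewrite (first_cartanE _ _ _ Az).
apply: homogZ; first exact: (smooth_dirD (vert a.1) (smooth_dirD (vert b.1) sme)).
by apply: homog_eq hab; ring.
Qed.

End First.

Section Second.
Variable C : TV R n -> TV R n -> TV R n -> TV R n.
Hypothesis sC : semibasic A C.
Hypothesis C_eq : forall X Y Z, smooth_on A X -> smooth_on A Y -> smooth_on A Z ->
  forall z, A z -> Omega E (app2 C X Y) Z z
    = 2%:R^-1 * lie2 (hproj S X) (metric E F) (J Y) (J Z) z.

Local Notation G := (nlc2 S).

Lemma bracket_hproj_vert a b z : A z ->
  bracket (hproj S (fun _ => a)) (fun _ => vert b) z = - vert (G z a.1 b).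
Proof.
move=> Az; rewrite bracketE dirD_cst sub0r.
rewrite (dirD_hproj fS (vert b) (smooth_cst A a) Az) /=.
by rewrite (dirD_hlift fS _ _ Az).
Qed.

(** The bracket of a horizontal lift with a constant vertical field is
    vertical, with component nlc2 up to sign. *)
Lemma second_cartanE z a b d : A z ->
  H (C z a b) (vert d) z
  = 2^-1 * ('d_(hlift S z a.1) (fun y => H (vert b.1) (vert d) y) z
            + H (vert (G z a.1 b.1)) (vert d) z
            + H (vert b.1) (vert (G z a.1 d)) z).
Proof.
move=> Az.
have smc u : smooth_on A (fun _ => u : TV R n) by exact: smooth_cst.
have := C_eq (smc a) (smc b) (smc (hor d)) Az.
rewrite (Omega_vert (hor d) (sb_smooth sC a b) Az (sb_vert sC a b Az)) => ->.
rewrite /lie2 -[J (fun _ => b)]/(fun _ => vert b.1) -[J (fun _ => hor d)]/(fun _ => vert d).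
have smh := smooth_hproj fS (smc a).
have smb := smooth_bracket oA smh (smc (vert b.1)).
have smd := smooth_bracket oA smh (smc (vert d)).
have vb : (bracket (hproj S (fun _ => a)) (fun _ => vert b.1) z).1 = 0.
  by rewrite (bracket_hproj_vert _ _ Az) /= oppr0.
have vd : (bracket (hproj S (fun _ => a)) (fun _ => vert d) z).1 = 0.
  by rewrite (bracket_hproj_vert _ _ Az) /= oppr0.
rewrite (metric_vert smb (smc (vert d)) Az vb erefl).
rewrite (metric_vert (smc (vert b.1)) smd Az erefl vd).
rewrite !(bracket_hproj_vert _ _ Az).
rewrite (linfN (linf_hessl oA smE _ Az)) (linfN (linf_hessr oA smE _ Az)) !opprK.
rewrite lie0E (hprojE fS (smc a) Az).
have e y : A y -> metric E F (fun _ => vert b.1) (fun _ => vert d) y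
    = H (vert b.1) (vert d) y.
  by move=> Ay; exact: (metric_vert (smc (vert b.1)) (smc (vert d)) Ay erefl erefl).
by rewrite (dirD_ext _ oA Az e).
Qed.

(** Euler's identity turns the three terms into the vertical derivative of d_h
    E = 0. *)
Lemma second_cartan_liouville z a b : A z -> b.1 = z.2 -> C z a b = 0.
Proof.
move=> Az bz; apply: (fund_inj fS Az) => [|d]; first by rewrite (sb_vert sC _ _ Az).
rewrite (second_cartanE _ _ _ Az) (hess0l fS _ Az) bz.
have he := homog_energy_vert d; have sme := smooth_dirD (vert d) smE.
set e1 := fun x => 'd_(vert d) E x.
have t1 : 'd_(hlift S z a.1) (fun y => H (vert z.2) (vert d) y) z
    = 'd_(hlift S z a.1) e1 z - 'd_(vert (nlc S z a.1)) e1 z.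
  rewrite -[X in 'd__ X z]/(fun y => 'd_(vert z.2) e1 y).
  rewrite (dirD_schwarz oA _ _ sme Az) -liouville_vert.
  pose proof (homog_dirD oA (hlift S z a.1) sme he Az) as e3.
  by rewrite e3 scale1r.
have t2 : H (vert (G z a.1 z.2)) (vert d) z = 'd_(vert (nlc S z a.1)) e1 z.
  by rewrite /nlc2 -liouville_vert (homog_nlc fS a.1 Az) scale1r.
have t3 : H (vert z.2) (vert (G z a.1 d)) z = 'd_(vert (G z a.1 d)) E z.
  rewrite -liouville_vert (hess_liouville fS _ Az) /=.
  by rewrite mulr2n mulrDl mul1r addrK.
have e4 : 'd_(vert d) (fun y => 'd_(hlift S y a.1) E y) z = 0.
  rewrite (dirD_ext (g := fun _ => 0) _ oA Az (fun y Ay => energy_hlift fS a.1 Ay)).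
  exact: dirD_cst.
pose proof (dirD_dirD_along oA smE (smooth_hlift fS a.1) (vert d) Az) as e5.
move: e5; rewrite e4 (dirD_hlift fS _ _ Az) (dirD_schwarz oA _ _ smE Az) => e5.
by rewrite t1 t2 t3 subrK -[X in _ * X]e5 mulr0.
Qed.

Lemma homog_second_cartan a b : homog A 0 (fun z => C z a b).
Proof.
apply: (homog_of_hess (sb_smooth sC a b) (fun z Az => sb_vert sC a b Az)) => d.
have he := homog_energy_vert; have sme u := smooth_dirD (vert u) smE.
pose f1 (y : TV R n) : R := 'd_(hlift S y a.1) (fun x => H (vert b.1) (vert d) x) y.
pose f2 (y : TV R n) : R := 'd_(vert (G y a.1 b.1)) (fun x => 'd_(vert d) E x) y.
pose f3 (y : TV R n) : R := 'd_(vert (G y a.1 d)) (fun x => 'd_(vert b.1) E x) y.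
have smG u : smooth_on A (fun y => vert (G y a.1 u)).
  apply: (smooth_linf_comp oA (@linf_vert R n) (@continuous_vert R n)).
  exact: (smooth_nlc2 fS).
have sm1 : smooth_on A f1.
  exact: (smooth_dirD_along oA (smooth_hess smE (vert b.1) (vert d)) (smooth_hlift fS a.1)).
have sm2 : smooth_on A f2 by exact: (smooth_dirD_along oA (sme d) (smG b.1)).
have sm3 : smooth_on A f3 by exact: (smooth_dirD_along oA (sme b.1) (smG d)).
apply: (homog_ext oA (f := fun z => 2^-1 *: (f1 z + f2 z + f3 z))) => [z Az|].
  by rewrite (second_cartanE _ _ _ Az) [H (vert b.1) _ _](hessC oA smE _ _ Az).
have h1 : homog A 0 (f1 : TV R n -> R).
  have h0 : homog A 0 (fun x => H (vert b.1) (vert d) x : R).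
    by apply: (homog_eq _ (homog_dirD_vert oA b.1 (sme d) (he d))); ring.
  exact (homog_dirD_hlift fS a.1 (smooth_hess smE (vert b.1) (vert d)) h0).
have h2 : homog A 0 (f2 : TV R n -> R).
  by apply: (homog_eq _ (homog_dirD_along_vert oA (sme d) (smooth_nlc2 fS a.1 b.1)
    (he d) (homog_nlc2 fS a.1 b.1))); ring.
have h3 : homog A 0 (f3 : TV R n -> R).
  by apply: (homog_eq _ (homog_dirD_along_vert oA (sme b.1) (smooth_nlc2 fS a.1 d)
    (he b.1) (homog_nlc2 fS a.1 d))); ring.
have sm12 := smoothD oA sm1 sm2.
apply: homogZ; first exact: (smoothD oA sm12 sm3).
by apply: homogD => //; apply: homogD.
Qed.

End Second.

End Tensors.

Arguments complex_on {R n} A S F.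

(** * Tensoriality of the curvature of a linear connection *)

Section Connection.
Context {R : realType} {n : nat} {A : set (TV R n)}.
Hypothesis oA : open A.

Record connection_on (D : vf R n -> endo R n) : Prop := ConnectionOn {
  cn_smooth : forall X Y, smooth_on A X -> smooth_on A Y -> smooth_on A (D X Y);
  cn_lin : forall X X' Y, smooth_on A X -> smooth_on A X' -> smooth_on A Y ->
    forall f : sf R n, smooth_on A f -> forall z, A z ->
    D (fun u => f u *: X u + X' u) Y z = f z *: D X Y z + D X' Y z;
  cn_leibniz : forall X Y Y', smooth_on A X -> smooth_on A Y -> smooth_on A Y' ->
    forall f : sf R n, smooth_on A f -> forall z, A z ->
    D X (fun u => f u *: Y u + Y' u) z
    = lie0 X f z *: Y z + f z *: D X Y z + D X Y' z }.

(** The field is expanded in the coordinate frame. *)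
Lemma tensorial (T : vf R n -> TV R n) z :
  (forall X X' (f : sf R n), smooth_on A X -> smooth_on A X' -> smooth_on A f ->
    T (fun u => f u *: X u + X' u) = f z *: T X + T X') ->
  forall X Y, smooth_on A X -> smooth_on A Y -> X z = Y z -> T X = T Y.
Proof.
move=> linT.
have T0 : T (fun _ => 0) = 0.
  have := linT _ _ _ (smooth_cst A (0 : TV R n)) (smooth_cst A (0 : TV R n))
    (smooth_cst A (1 : R)).
  rewrite scale1r addr0 scale1r => /esym/eqP.
  by rewrite -subr_eq0 addrK => /eqP.
pose crd := @fd_crd _ _ (findim_TV R n).
pose bas := @fd_bas _ _ (findim_TV R n).
suff TE X : smooth_on A X ->
    T X = \sum_k crd k (X z) *: T (fun _ => bas k).
  by move=> X Y smX smY e; rewrite (TE X smX) (TE Y smY) e.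
move=> smX.
have {1}-> : X = fun u => \sum_k crd k (X u) *: bas k.
  by apply: funext => u; exact: fd_sum.
suff : T (fun u => \sum_k crd k (X u) *: bas k)
      = \sum_k crd k (X z) *: T (fun _ => bas k) /\
    smooth_on A (fun u => \sum_k crd k (X u) *: bas k) by case.
elim: (index_enum _) => [|k s [IHs sms]].
  split; last by under eq_fun do rewrite big_nil; exact: smooth_cst.
  by rewrite big_nil -[RHS]T0; congr T; apply: funext => u; rewrite big_nil.
have smk : smooth_on A (fun u => crd k (X u) : R) by exact: smooth_crd.
have smb : smooth_on A (fun _ => bas k : TV R n) by exact: smooth_cst.
split; last first.
  under eq_fun do rewrite big_cons.
  by apply: smoothD => //; exact: smoothZ.
rewrite big_cons -IHs -(linT _ _ _ smb sms smk).
by congr T; apply: funext => u; rewrite big_cons.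
Qed.

Variable D : vf R n -> endo R n.
Hypothesis cD : connection_on D.

Lemma conn_pointwise X X' Y z : smooth_on A X -> smooth_on A X' -> smooth_on A Y ->
  A z -> X z = X' z -> D X Y z = D X' Y z.
Proof.
move=> smX smX' smY Az; apply: (tensorial (T := fun X => D X Y z)) smX smX'.
by move=> V V' f smV smV' smf; exact: (cn_lin cD smV smV' smY smf Az).
Qed.

Lemma linf_conn Y z : smooth_on A Y -> A z -> is_linear (fun a => D (fun _ => a) Y z).
Proof.
move=> smY Az c a b.
exact: (cn_lin cD (smooth_cst A a) (smooth_cst A b) smY (smooth_cst A c) Az).
Qed.

Lemma conn_cst X Y z : smooth_on A X -> smooth_on A Y -> A z ->
  D X Y z = D (fun _ => X z) Y z.
Proof. by move=> smX smY Az; apply: conn_pointwise => //; exact: smooth_cst. Qed.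

(** The Leibniz rule is applied to the indicator of the complement of A, which
    is smooth on A and vanishes there. *)
Lemma conn_local X Y Y' z : smooth_on A X -> smooth_on A Y -> smooth_on A Y' ->
  A z -> (forall y, A y -> Y y = Y' y) -> D X Y z = D X Y' z.
Proof.
move=> smX smY smY' Az YY'.
(* f (Y - Y') = Y - Y', because Y - Y' vanishes on A and f = 1 elsewhere *)
pose f : sf R n := fun u => if `[< A u >] then 0 else 1.
have f0 y : A y -> 0 = f y by move=> Ay; rewrite /f; case: asboolP.
have smf : smooth_on A f by apply: (smooth_ext oA f0); exact: smooth_cst.
have smB : smooth_on A (fun u => Y u - Y' u) by exact: smoothB.
have eY : Y = fun u => f u *: (Y u - Y' u) + Y' u.
  apply: funext => u; rewrite /f; case: asboolP => Au; last by rewrite scale1r subrK.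
  by rewrite scale0r add0r YY'.
rewrite eY (cn_leibniz cD smX smB smY' smf Az) -(f0 z Az) scale0r addr0.
by rewrite (YY' z Az) subrr scaler0 add0r.
Qed.

Lemma conn0r X z : smooth_on A X -> A z -> D X (fun _ => 0) z = 0.
Proof.
move=> smX Az.
have := cn_leibniz cD smX (smooth_cst A (0 : TV R n)) (smooth_cst A (0 : TV R n))
  (smooth_cst A (1 : R)) Az.
rewrite scale1r addr0 scaler0 add0r scale1r => /esym/eqP.
by rewrite -subr_eq0 addrK => /eqP.
Qed.

Lemma smooth_lie0 X (f : sf R n) : smooth_on A X -> smooth_on A f -> smooth_on A (lie0 X f).
Proof. by move=> smX smf; rewrite lie0E; exact: (smooth_dirD_along oA smf smX). Qed.

Lemma lie0_bracket X Y (f : sf R n) z : smooth_on A X -> smooth_on A Y ->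
  smooth_on A f -> A z ->
  lie0 (bracket X Y) f z = lie0 X (lie0 Y f) z - lie0 Y (lie0 X f) z.
Proof.
move=> smX smY smf Az; rewrite !lie0E bracketE.
have lf : is_linear (fun v => 'd_v f z : R) by exact (dirD_linf oA smf Az).
pose proof (dirD_dirD_along oA smf smY (X z) Az) as e1.
pose proof (dirD_dirD_along oA smf smX (Y z) Az) as e2.
rewrite e1 e2 (dirD_schwarz oA (Y z) (X z) smf Az) (linfB lf).
by rewrite opprD addrACA subrr add0r.
Qed.

Lemma curvatureE X Y Z z : smooth_on A X -> smooth_on A Y -> smooth_on A Z -> A z ->
  curvature D X Y Z z =
  D X (D Y Z) z - D Y (D X Z) z - D (fun _ => bracket X Y z) Z z.
Proof.
move=> smX smY smZ Az.
exact: (congr1 (fun w => D X (D Y Z) z - D Y (D X Z) z - w)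
  (conn_cst (smooth_bracket oA smX smY) smZ Az)).
Qed.

Lemma smooth_curvature X Y Z : smooth_on A X -> smooth_on A Y -> smooth_on A Z ->
  smooth_on A (curvature D X Y Z).
Proof.
move=> smX smY smZ.
have smD V W : smooth_on A V -> smooth_on A W -> smooth_on A (D V W) by exact: cn_smooth.
apply: (smoothB oA); last by apply: smD => //; exact: smooth_bracket.
by apply: (smoothB oA); apply: (smD) => //; exact: smD.
Qed.

Lemma curvature_antisym X Y Z z : smooth_on A X -> smooth_on A Y -> smooth_on A Z ->
  A z -> curvature D X Y Z z = - curvature D Y X Z z.
Proof.
move=> smX smY smZ Az; rewrite !curvatureE//.
have -> : bracket Y X z = - bracket X Y z by rewrite !bracketE opprB.
by rewrite (linfN (linf_conn smZ Az)) opprK opprD opprB.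
Qed.

(** The derivative of f that comes from D_Y cancels against the one in [f X,
    Y] = f [X, Y] - Y(f) X. *)
Lemma curvature_linl X X' Y Z (f : sf R n) z : smooth_on A X -> smooth_on A X' ->
  smooth_on A f -> smooth_on A Y -> smooth_on A Z -> A z ->
  curvature D (fun u => f u *: X u + X' u) Y Z z
  = f z *: curvature D X Y Z z + curvature D X' Y Z z.
Proof.
move=> smX smX' smf smY smZ Az.
have smDXZ := cn_smooth cD smX smZ; have smDX'Z := cn_smooth cD smX' smZ.
have smDYZ := cn_smooth cD smY smZ.
have smfX : smooth_on A (fun u => f u *: X u) by exact: smoothZ.
have smV : smooth_on A (fun u => f u *: X u + X' u) by exact: smoothD.
have smW : smooth_on A (fun u => f u *: D X Z u + D X' Z u).
  by apply: smoothD => //; exact: smoothZ.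
rewrite !curvatureE//.
rewrite (cn_lin cD smX smX' smDYZ smf Az).
have e1 : D Y (D (fun u => f u *: X u + X' u) Z) z
    = D Y (fun u => f u *: D X Z u + D X' Z u) z.
  apply: (conn_local smY (cn_smooth cD smV smZ) smW Az) => y Ay.
  exact: (cn_lin cD smX smX' smZ smf Ay).
rewrite e1 (cn_leibniz cD smY smDXZ smDX'Z smf Az).
have -> : bracket (fun u => f u *: X u + X' u) Y z
    = f z *: bracket X Y z + (bracket X' Y z - lie0 Y f z *: X z).
  rewrite !bracketE lie0E (dirDD (Y z) smfX smX' Az).
  have lY : is_linear (fun v => 'd_v Y z) by exact (dirD_linf oA smY Az).
  rewrite lY.
  have -> : 'd_(Y z) (fun u => f u *: X u) z = 'd_(Y z) f z *: X z + f z *: 'd_(Y z) X z.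
    rewrite !dirDE.
    have df : is_derive z (Y z) f ('D_(Y z) f z) by apply: smooth_is_derive Az.
    have dX : is_derive z (Y z) X ('D_(Y z) X z) by apply: smooth_is_derive Az.
    by have [_ ->] := is_deriveZf df dX.
  by apply fd_inj => k; rewrite !fd_crdE; ring.
have lD := linf_conn smZ Az.
move: (bracket X Y z) (bracket X' Y z) => b b'.
rewrite lD (linfB lD) (linfZ lD) -(conn_cst smX smZ Az).
by apply fd_inj => k; rewrite !fd_crdE; ring.
Qed.

(** The second derivatives of f cancel because [X, Y](f) = X(Y(f)) - Y(X(f)).
    *)
Lemma curvature_linr X Y Z Z' (f : sf R n) z : smooth_on A Z -> smooth_on A Z' ->
  smooth_on A f -> smooth_on A X -> smooth_on A Y -> A z ->
  curvature D X Y (fun u => f u *: Z u + Z' u) z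
  = f z *: curvature D X Y Z z + curvature D X Y Z' z.
Proof.
move=> smZ smZ' smf smX smY Az.
have smfZ : smooth_on A (fun u => f u *: Z u) by exact: smoothZ.
have smV : smooth_on A (fun u => f u *: Z u + Z' u) by exact: smoothD.
have second V W : smooth_on A V -> smooth_on A W ->
    D V (D W (fun u => f u *: Z u + Z' u)) z
    = lie0 V (lie0 W f) z *: Z z + lie0 W f z *: D V Z z
      + (lie0 V f z *: D W Z z + f z *: D V (D W Z) z + D V (D W Z') z).
  move=> sV sW.
  have sl := smooth_lie0 sW smf.
  have sDZ := cn_smooth cD sW smZ; have sDZ' := cn_smooth cD sW smZ'.
  have sfD : smooth_on A (fun u => f u *: D W Z u + D W Z' u).
    by apply: smoothD => //; exact: smoothZ.
  have sm1 : smooth_on A (fun u => lie0 W f u *: Z u + (f u *: D W Z u + D W Z' u)).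
    by apply: smoothD => //; exact: smoothZ.
  rewrite (conn_local (Y' := fun u => lie0 W f u *: Z u + (f u *: D W Z u + D W Z' u))
    sV (cn_smooth cD sW smV) sm1 Az); last first.
    by move=> y Ay; rewrite (cn_leibniz cD sW smZ smZ' smf Ay) addrA.
  by rewrite (cn_leibniz cD sV smZ sfD sl Az) (cn_leibniz cD sV sDZ sDZ' smf Az).
have sB := smooth_bracket oA smX smY; have eB := lie0_bracket smX smY smf Az.
rewrite /curvature (second X Y smX smY) (second Y X smY smX).
move: (bracket X Y) sB eB => B sB eB.
rewrite (cn_leibniz cD sB smZ smZ' smf Az) eB.
exact: leibniz_cancel.
Qed.

(** This reduces curvature computations to lifts of constant vectors and
    constant vertical fields. *)
Lemma curvature_pointwise X Y Z X' Y' Z' z :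
  smooth_on A X -> smooth_on A Y -> smooth_on A Z ->
  smooth_on A X' -> smooth_on A Y' -> smooth_on A Z' -> A z ->
  X z = X' z -> Y z = Y' z -> Z z = Z' z ->
  curvature D X Y Z z = curvature D X' Y' Z' z.
Proof.
move=> smX smY smZ smX' smY' smZ' Az eX eY eZ.
have first V V' W U : smooth_on A V -> smooth_on A V' -> smooth_on A W ->
    smooth_on A U -> V z = V' z -> curvature D V W U z = curvature D V' W U z.
  move=> sV sV' sW sU; apply: (tensorial (T := fun V => curvature D V W U z)) sV sV'.
  by move=> P Q f smP smQ smf; exact: curvature_linl.
rewrite (first X X')//.
rewrite (curvature_antisym smX' smY smZ Az) (first Y Y')//.
rewrite -(curvature_antisym smX' smY' smZ Az).
apply: (tensorial (T := fun V => curvature D X' Y' V z)) smZ smZ' eZ.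
by move=> P Q f smP smQ smf; exact: curvature_linr.
Qed.

End Connection.

Arguments connection_on {R n} A D.

(** * The Cartan connection and the Bianchi identity *)

Section Cartan.
Context {R : realType} {n : nat} {A : set (TV R n)} {E : sf R n} {S : vf R n}.
Context {F : TV R n -> TV R n -> TV R n} {C C' : TV R n -> TV R n -> TV R n -> TV R n}.
Context {D : vf R n -> endo R n}.

(** The structures of the theorem in one chart, with the Berwald connection
    eliminated from the equations of the Cartan connection. *)
Record cartan_on : Prop := CartanOn {
  ct_spray : finsler_spray A E S;
  ct_complex : complex_on A S F;
  ct_first : semibasic A C;
  ct_second : semibasic A C';
  ct_first_eq : forall X Y Z, smooth_on A X -> smooth_on A Y -> smooth_on A Z ->
    forall z, A z -> Omega E (app2 C X Y) Z z
      = 2%:R^-1 * lie2 (J X) (pullJ (metric E F)) Y Z z;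
  ct_second_eq : forall X Y Z, smooth_on A X -> smooth_on A Y -> smooth_on A Z ->
    forall z, A z -> Omega E (app2 C' X Y) Z z
      = 2%:R^-1 * lie2 (hproj S X) (metric E F) (J Y) (J Z) z;
  ct_conn : connection_on A D;
  ct_vert : forall X Y, smooth_on A X -> smooth_on A Y -> forall z, A z ->
    D (J X) (J Y) z = J (bracket (J X) Y) z + app2 C X Y z;
  ct_hor : forall X Y, smooth_on A X -> smooth_on A Y -> forall z, A z ->
    D (hproj S X) (J Y) z
    = vproj S (bracket (hproj S X) (J Y)) z + app2 C' X Y z }.

Hypothesis ct : cartan_on.

Let fS := ct_spray ct.
Let oA := fs_open fS.
Let cD := ct_conn ct.
Let sC := ct_first ct.
Let sC' := ct_second ct.

Local Notation N := (nlc S).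
Local Notation hl := (hlift S).
Local Notation G := (nlc2 S).

Definition hfield (a : 'rV[R]_n) : vf R n := fun z => hlift S z a.

Lemma smooth_hfield a : smooth_on A (hfield a).
Proof. exact: smooth_hlift fS a. Qed.

(** The component of the covariant derivative of the vertical field vert w
    along the horizontal lift of a. *)
Definition nabla (a : 'rV[R]_n) (w : TV R n -> 'rV[R]_n) (z : TV R n) : 'rV[R]_n :=
  'd_(hl z a) w z - G z a (w z) + (C' z (hor a) (hor (w z))).2.

Lemma conn_hor a w z : smooth_on A w -> A z ->
  D (hfield a) (fun y => vert (w y)) z = vert (nabla a w z).
Proof.
move=> smw Az.
have sma : smooth_on A (fun _ => hor a) by exact: smooth_cst.
have smh := smooth_hproj fS sma; have smv := smooth_vert oA smw.
have e1 := ct_hor ct sma (smooth_hor oA smw) Az.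
have e2 : D (hfield a) (fun y => vert (w y)) z
    = D (hproj S (fun _ => hor a)) (J (fun y => hor (w y))) z.
  apply: (conn_pointwise oA cD (smooth_hfield a) smh smv Az).
  by rewrite (hprojE fS sma Az).
rewrite e2 e1 (vprojE fS (smooth_bracket oA smh smv) Az).
have -> : bracket (hproj S (fun _ => hor a)) (J (fun y => hor (w y))) z
    = vert ('d_(hl z a) w z - G z a (w z)).
  rewrite bracketE (hprojE fS sma Az) (dirD_hproj fS _ sma Az) /=.
  rewrite (dirD_hlift fS _ _ Az) (dirD_vert _ smw Az).
  by rewrite -(linfB (@linf_vert R n)).
rewrite /= (linf0 (linf_nlc fS Az)) subr0 /app2.
by rewrite [C' _ _ _]TV_vert ?(sb_vert sC' _ _ Az)// -(linfD (@linf_vert R n)).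
Qed.

Lemma conn_vert k c z : A z ->
  D (fun _ => vert k) (fun _ => vert c) z = C z (hor k) (hor c).
Proof.
move=> Az; have := ct_vert ct (smooth_cst A (hor k)) (smooth_cst A (hor c)) Az.
rewrite -[J (fun _ => hor k)]/(fun _ => vert k) bracket_cst => ->.
by rewrite -[J _ z]/(0 : TV R n) add0r.
Qed.

Lemma smooth_nabla a w : smooth_on A w -> smooth_on A (nabla a w).
Proof.
move=> smw; apply: smoothD => //; first apply: smoothB => //.
- exact: (smooth_dirD_along oA smw (smooth_hfield a)).
- exact: (smooth_dirD_along oA (smooth_nlc fS a) (smooth_vert oA smw)).
apply: smooth_snd => //.
exact: (smooth_linfam oA (linfam_semibasic sC' (hor a)) (smooth_hor oA smw)).
Qed.

Lemma nabla_ext a w w' z : A z -> (forall y, A y -> w y = w' y) ->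
  nabla a w z = nabla a w' z.
Proof. by move=> Az e; rewrite /nabla (dirD_ext _ oA Az e) (e z Az). Qed.

(** The Berwald coefficients are symmetric as second derivatives of the spray,
    and C' is symmetric. *)
Lemma nabla_cstC a b z : A z -> nabla a (fun _ => b) z = nabla b (fun _ => a) z.
Proof.
move=> Az; rewrite /nabla !dirD_cst (nlc2C fS _ _ Az).
by rewrite (sb_sym sC' _ _ Az).
Qed.

(** The fibre component of the bracket of two horizontal lifts, which is
    vertical. *)
Definition hcommutator (a b : 'rV[R]_n) (z : TV R n) : 'rV[R]_n :=
  'd_(hl z a) (fun y => N y b) z - 'd_(hl z b) (fun y => N y a) z.

Lemma bracket_hfield a b z : A z ->
  bracket (hfield a) (hfield b) z = vert (hcommutator a b z).
Proof.
move=> Az; rewrite bracketE /hfield !(dirD_hlift fS _ _ Az).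
by rewrite -(linfB (@linf_vert R n)).
Qed.

Lemma smooth_hcommutator a b : smooth_on A (hcommutator a b).
Proof.
apply: smoothB => //.
  exact: (smooth_dirD_along oA (smooth_nlc fS b) (smooth_hfield a)).
exact: (smooth_dirD_along oA (smooth_nlc fS a) (smooth_hfield b)).
Qed.

Definition hcurv0 (a b c : 'rV[R]_n) : vf R n :=
  curvature D (hfield a) (hfield b) (fun _ => vert c).

Lemma hcurvE X Y Z z : smooth_on A X -> smooth_on A Y -> smooth_on A Z -> A z ->
  hcurv S D X Y Z z = hcurv0 (X z).1 (Y z).1 (Z z).1 z.
Proof.
move=> smX smY smZ Az.
apply: (curvature_pointwise oA cD (smooth_hproj fS smX) (smooth_hproj fS smY)
  (smooth_J oA smZ) (smooth_hfield (X z).1) (smooth_hfield (Y z).1)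
  (smooth_cst A (vert (Z z).1)) Az).
- by rewrite (hprojE fS smX Az).
- by rewrite (hprojE fS smY Az).
by [].
Qed.

Lemma hcurv0E a b c z : A z ->
  hcurv0 a b c z
  = vert (nabla a (nabla b (fun _ => c)) z - nabla b (nabla a (fun _ => c)) z)
    - C z (hor (hcommutator a b z)) (hor c).
Proof.
move=> Az.
have smc : smooth_on A (fun _ => vert c) by exact: smooth_cst.
have smk u : smooth_on A (fun _ : TV R n => u : 'rV[R]_n) by exact: smooth_cst.
have twice u v : D (hfield u) (D (hfield v) (fun _ => vert c)) z
    = vert (nabla u (nabla v (fun _ => c)) z).
  rewrite -(conn_hor _ (smooth_nabla v (smk c)) Az).
  apply: (conn_local oA cD (smooth_hfield u) (cn_smooth cD (smooth_hfield v) smc)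
    (smooth_vert oA (smooth_nabla v (smk c))) Az) => y Ay.
  exact (conn_hor v (smk c) Ay).
rewrite /hcurv0 (curvatureE oA cD (smooth_hfield a) (smooth_hfield b) smc Az).
rewrite (bracket_hfield _ _ Az) (conn_vert _ _ Az) !twice.
by rewrite -(linfB (@linf_vert R n)).
Qed.

(** By symmetry of nabla on constant vectors the second covariant derivatives
    cancel in the cyclic sum, and only the terms of the vertical brackets of
    horizontal lifts are left. *)
Lemma hcurv0_bianchi a b c z : A z ->
  hcurv0 a b c z + hcurv0 b c a z + hcurv0 c a b z
  = - (C z (hor (hcommutator a b z)) (hor c) + C z (hor (hcommutator b c z)) (hor a)
       + C z (hor (hcommutator c a z)) (hor b)).
Proof.
move=> Az; rewrite !(hcurv0E _ _ _ Az).
have sym u v w : nabla u (nabla v (fun _ => w)) z = nabla u (nabla w (fun _ => v)) z.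
  by apply: nabla_ext => // y Ay; exact: nabla_cstC.
(* the subtracted second derivatives become the added ones *)
rewrite (sym b a c) (sym c b a) (sym a c b).
rewrite !(linfB (@linf_vert R n)).
set p := vert _; set q := vert _; set r := vert _.
set c1 := C _ _ _; set c2 := C _ _ _; set c3 := C _ _ _.
by apply fd_inj => k; rewrite !fd_crdE; ring.
Qed.

Lemma homog_nabla k a w : smooth_on A w -> homog A k w -> homog A k (nabla a w).
Proof.
move=> smw hw.
have smh := smooth_hor oA smw.
have sm1 : smooth_on A (fun y => 'd_(hl y a) w y).
  exact: (smooth_dirD_along oA smw (smooth_hfield a)).
have sm2 : smooth_on A (fun y => G y a (w y)).
  exact: (smooth_dirD_along oA (smooth_nlc fS a) (smooth_vert oA smw)).
have sm3 : smooth_on A (fun y => C' y (hor a) (hor (w y))).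
  exact: (smooth_linfam oA (linfam_semibasic sC' (hor a)) smh).
have h1 : homog A k (fun y => 'd_(hl y a) w y).
  exact (homog_dirD_hlift fS a smw hw).
have h2 : homog A k (fun y => G y a (w y)).
  have hN := homog_nlc fS a.
  pose proof (homog_dirD_along_vert oA (smooth_nlc fS a) smw hN hw) as h.
  by apply: homog_eq h; ring.
have h3 : homog A k (fun y => C' y (hor a) (hor (w y))).
  have hC b : homog A 0 (fun y => C' y (hor a) b).
    exact: (homog_second_cartan fS (ct_complex ct) sC' (ct_second_eq ct)).
  have hh : homog A k (fun y => hor (w y)).
    move=> y Ay.
    rewrite (dirD_linf_comp _ (@linf_hor R n) (@continuous_inl _ _ _) smw Ay).
    by rewrite (hw y Ay) (linfZ (@linf_hor R n)).
  pose proof (homog_linfam oA (linfam_semibasic sC' (hor a)) smh hC hh) as h.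
  by apply: homog_eq h; ring.
have sm12 := smoothB oA sm1 sm2.
apply: homogD => //; [exact: smooth_snd|exact: homogB|].
by move=> y Ay; rewrite (dirD_snd _ sm3 Ay) (h3 y Ay).
Qed.

Lemma homog_hcommutator a b : homog A 1 (hcommutator a b).
Proof.
apply: homogB.
- exact: (smooth_dirD_along oA (smooth_nlc fS b) (smooth_hfield a)).
- exact: (smooth_dirD_along oA (smooth_nlc fS a) (smooth_hfield b)).
- exact (homog_dirD_hlift fS a (smooth_nlc fS b) (homog_nlc fS b)).
exact (homog_dirD_hlift fS b (smooth_nlc fS a) (homog_nlc fS a)).
Qed.

Lemma smooth_hcurv0 a b c : smooth_on A (hcurv0 a b c).
Proof.
apply: (smooth_curvature oA cD (smooth_hfield a) (smooth_hfield b)).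
exact: smooth_cst.
Qed.

(** Covariant derivatives preserve degrees, the first Cartan tensor has degree
    -1 and the bracket of two lifts has degree 1. *)
Lemma homog_hcurv0 a b c : homog A 0 (hcurv0 a b c).
Proof.
have smc : smooth_on A (fun _ : TV R n => c) by exact: smooth_cst.
have hc : homog A 0 (fun _ : TV R n => c) by exact: homog_cst.
pose p (u v : 'rV[R]_n) := nabla u (nabla v (fun _ => c)).
have smp u v : smooth_on A (p u v) by do 2 apply: smooth_nabla.
have hp u v : homog A 0 (p u v).
  by apply: homog_nabla; [exact: smooth_nabla|exact: homog_nabla].
have smk := smooth_hor oA (smooth_hcommutator a b).
have smC : smooth_on A (fun z => C z (hor c) (hor (hcommutator a b z))).
  exact: (smooth_linfam oA (linfam_semibasic sC (hor c)) smk).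
have hC : homog A 0 (fun z => C z (hor c) (hor (hcommutator a b z))).
  have hC u : homog A (-1) (fun y => C y (hor c) u).
    exact: (homog_first_cartan fS (ct_complex ct) sC (ct_first_eq ct)).
  have hh : homog A 1 (fun y => hor (hcommutator a b y)).
    move=> y Ay; rewrite (dirD_linf_comp _ (@linf_hor R n) (@continuous_inl _ _ _)
      (smooth_hcommutator a b) Ay).
    by rewrite (homog_hcommutator a b Ay) (linfZ (@linf_hor R n)).
  pose proof (homog_linfam oA (linfam_semibasic sC (hor c)) smk hC hh) as h.
  by apply: homog_eq h; ring.
have smq : smooth_on A (fun z => p a b z - p b a z) by exact: smoothB.
apply: (homog_ext oA (f := fun z => vert (p a b z - p b a z)
    - C z (hor c) (hor (hcommutator a b z)))) => [z Az|].
  by rewrite (hcurv0E _ _ _ Az) (sb_sym sC (hor c) _ Az).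
apply: homogB => //; first exact: smooth_vert.
move=> z Az; rewrite (dirD_vert _ smq Az).
have hq : homog A 0 (fun z => p a b z - p b a z) by exact: homogB.
by rewrite (hq z Az) (linfZ (@linf_vert R n)).
Qed.

Lemma linf_hcurv0 b c z : A z -> is_linear (fun a => hcurv0 a b c z).
Proof.
move=> Az t a a'.
have smc : smooth_on A (fun _ => vert c) by exact: smooth_cst.
have smt : smooth_on A (fun _ : TV R n => t) by exact: smooth_cst.
have sma := smooth_hfield.
rewrite -(curvature_linl oA cD (sma a) (sma a') smt (sma b) smc Az).
have smX : smooth_on A (fun u => t *: hfield a u + hfield a' u).
  by apply: smoothD => //; exact: smoothZ.
apply: (curvature_pointwise oA cD (sma _) (sma b) smc smX (sma b) smc Az) => //.
by rewrite /hfield (linf_hlift fS Az).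
Qed.

Lemma hcurv0_antisym a b c z : A z -> hcurv0 a b c z = - hcurv0 b a c z.
Proof.
move=> Az; apply: (curvature_antisym oA cD (smooth_hfield a) (smooth_hfield b) _ Az).
exact: smooth_cst.
Qed.

End Cartan.

Arguments hfield {R n} S a.
Arguments hcommutator {R n} S a b z.
Arguments hcurv0 {R n} S D a b c.
Arguments cartan_on {R n} A E S F C C' D.

(** * Nullity vectors in a chart *)

Section Nullity.
Context {R : realType} {n : nat} {A : set (TV R n)} {E : sf R n} {S : vf R n}.
Context {F : TV R n -> TV R n -> TV R n} {C C' : TV R n -> TV R n -> TV R n -> TV R n}.
Context {D : vf R n -> endo R n}.
Hypothesis ct : cartan_on A E S F C C' D.

Let fS := ct_spray ct.
Let oA := fs_open fS.
Let smS := fs_spray fS.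
Let cD := ct_conn ct.
Let sC := ct_first ct.
Let sC' := ct_second ct.

Local Notation hl := (hlift S).

(** JS is the Liouville field C. The second Cartan tensor vanishes on S, and
    [hX, C] is horizontal because horizontal lifts of constant vectors commute
    with C. *)
Lemma conn_hor_spray X z : smooth_on A X -> A z -> D (hproj S X) (J S) z = 0.
Proof.
move=> smX Az; rewrite (ct_hor ct smX smS Az) /app2.
rewrite (second_cartan_liouville fS (ct_complex ct) sC' (ct_second_eq ct) _ Az
  (spray_base fS Az)) addr0.
have smh := smooth_hproj fS smX; have smJ := smooth_J oA smS.
have smX1 := smooth_fst oA smX.
rewrite (vprojE fS (smooth_bracket oA smh smJ) Az).
suff -> : bracket (hproj S X) (J S) z = - hl z ('d_(liouville z) (fun y => (X y).1) z).
  by rewrite /= (linfN (linf_nlc fS Az)) opprK addNr.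
have eJ y : A y -> J S y = liouville y.
  by move=> Ay; rewrite /J /tangentJ (spray_base fS Ay).
rewrite (bracket_ext oA Az (X' := fun y => hl y (X y).1) (Y' := @liouville R n))//; last first.
  by move=> y Ay; rewrite (hprojE fS smX Ay).
rewrite bracketE dirD_liouville.
pose proof (dirD_linfam oA (linfam_hlift fS) smX1 (liouville z) Az) as e.
rewrite e (dirD_hlift fS _ _ Az) (homog_nlc fS _ Az) scale1r /=.
by rewrite opprD addrA subrr sub0r.
Qed.

(** By [conn_hor_spray] only the vertical part Jq of V contributes; there the
    first Cartan tensor vanishes on S and J [Jq, S] = Jq. *)
Lemma conn_spray V z : smooth_on A V -> A z -> D V (J S) z = vproj S V z.
Proof.
move=> smV Az; have smJ := smooth_J oA smS.
rewrite (conn_cst oA cD smV smJ Az) (vprojE fS smV Az).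
set q := (V z).2 - _.
have -> : V z = hl z (V z).1 + vert q.
  rewrite [LHS](surjective_pairing (V z)); congr (_, _); rewrite /=; first by rewrite addr0.
  by rewrite addrC subrK.
rewrite (linfD (linf_conn cD smJ Az)).
have smh : smooth_on A (fun _ => hor (V z).1) by exact: smooth_cst.
have -> : D (fun _ => hl z (V z).1) (J S) z = 0.
  rewrite -[RHS](conn_hor_spray smh Az).
  apply: (conn_pointwise oA cD (smooth_cst A _) (smooth_hproj fS smh) smJ Az).
  by rewrite (hprojE fS smh Az).
have smq : smooth_on A (fun _ => hor q) by exact: smooth_cst.
rewrite add0r; have := ct_vert ct smq smS Az.
rewrite -[J (fun _ => hor q)]/(fun _ => vert q) => ->.
rewrite /app2 (first_cartan_liouville fS (ct_complex ct) sC (ct_first_eq ct) _ Az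
  (spray_base fS Az)) addr0.
rewrite /J bracketE dirD_cst subr0 (dirD_S fS _ Az).
by [].
Qed.

(** Of K(hX, hY)JS only the term with the bracket [hX, hY] is left, and it is
    computed by [conn_spray]. *)
Lemma hcurv_spray X Y z : smooth_on A X -> smooth_on A Y -> A z ->
  hcurv S D X Y S z = barthel_curv S X Y z.
Proof.
move=> smX smY Az; rewrite (barthel_curvE fS smX smY Az).
have smhX := smooth_hproj fS smX; have smhY := smooth_hproj fS smY.
have smJ := smooth_J oA smS.
have vanish U V : smooth_on A U -> smooth_on A V ->
    D (hproj S U) (D (hproj S V) (J S)) z = 0.
  move=> smU smV; have smhU := smooth_hproj fS smU; have smhV := smooth_hproj fS smV.
  rewrite -[RHS](conn0r cD smhU Az).
  apply: (conn_local oA cD smhU (cn_smooth cD smhV smJ) (smooth_cst A 0) Az) => y Ay.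
  exact: conn_hor_spray.
pose proof (conn_spray (smooth_bracket oA smhX smhY) Az) as e.
have eX := vanish X Y smX smY; have eY := vanish Y X smY smX.
have sum3 (a b c w : TV R n) : a = 0 -> b = 0 -> c = w -> a - b - c = - w.
  by move=> -> -> ->; rewrite subr0 sub0r.
exact: sum3 eX eY e.
Qed.

(** The Barthel curvature is tensorial since R(X, Y)S is, so X and Y can be
    taken constant. *)
Lemma barthel_curv0E X Y z : smooth_on A X -> smooth_on A Y -> A z ->
  barthel_curv S X Y z = - vert (hcommutator S (X z).1 (Y z).1 z).
Proof.
move=> smX smY Az.
set a := (X z).1; set b := (Y z).1.
have sma : smooth_on A (fun _ => hor a) by exact: smooth_cst.
have smb : smooth_on A (fun _ => hor b) by exact: smooth_cst.
rewrite -(hcurv_spray smX smY Az) (hcurvE ct smX smY smS Az) -/a -/b.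
rewrite -[LHS](hcurvE ct sma smb smS Az) (hcurv_spray sma smb Az).
rewrite (barthel_curvE fS sma smb Az).
have smha := smooth_hproj fS sma; have smhb := smooth_hproj fS smb.
rewrite (vprojE fS (smooth_bracket oA smha smhb) Az); congr (- vert _).
rewrite (bracket_ext (X' := hfield S a) (Y' := hfield S b) oA Az).
- by rewrite (bracket_hfield ct _ _ Az) /= (linf0 (linf_nlc fS Az)) subr0.
- by move=> y Ay; rewrite (hprojE fS sma Ay).
by move=> y Ay; rewrite (hprojE fS smb Ay).
Qed.

(** Two of the curvature terms in the Bianchi identity have the nullity vector
    Z as an argument before the last one, and two of the Barthel curvatures
    involve Z. *)
Lemma hcurv_null X Y Z z : smooth_on A X -> smooth_on A Y -> smooth_on A Z -> A z ->
  (forall U V, smooth_on A U -> smooth_on A V -> hcurv S D Z U V z = 0) ->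
  hcurv S D X Y Z z = C z (F z (barthel_curv S X Y z)) (Z z).
Proof.
move=> smX smY smZ Az nullZ.
have k0 (U : vf R n) : smooth_on A U -> hcommutator S (Z z).1 (U z).1 z = 0.
  move=> smU; have e : vert (hcommutator S (Z z).1 (U z).1 z) = 0.
    apply/eqP; rewrite -oppr_eq0 -(barthel_curv0E smZ smU Az).
    by rewrite -(hcurv_spray smZ smU Az) (nullZ U S smU smS).
  exact: (congr1 snd e).
have kC a b : hcommutator S a b z = - hcommutator S b a z by rewrite opprB.
have C0 v : C z (hor 0) v = 0.
  by rewrite (sb_sym sC _ _ Az); exact: linf0 (sb_linf sC v Az).
have CN u v : C z (hor (- u)) v = - C z (hor u) v.
  rewrite (linfN (@linf_hor R n)) (sb_sym sC _ _ Az) (linfN (sb_linf sC v Az)).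
  by rewrite (sb_sym sC v _ Az).
rewrite (barthel_curv0E smX smY Az) (linfN ((cx_linfam (ct_complex ct)).1 z Az)).
rewrite (cx_vert fS (ct_complex ct) _ Az).
rewrite (semibasic_base sC _ _ Az) [(- _).1]/= CN (hcurvE ct smX smY smZ Az).
have := hcurv0_bianchi ct (X z).1 (Y z).1 (Z z).1 Az.
rewrite (hcurv0_antisym ct (Y z).1 _ _ Az).
rewrite (kC (Y z).1) (k0 X smX) (k0 Y smY) oppr0 !C0 !addr0 => <-.
rewrite -(hcurvE ct smZ smY smX Az) (nullZ Y X smY smX).
by rewrite -(hcurvE ct smZ smX smY Az) (nullZ X Y smX smY) oppr0 !addr0.
Qed.

(** R(X, b)c = 0 is differentiated along the Liouville field; the components
    of R have degree 0, so only R([C, X], b)c is left. *)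
Lemma null_bracket_liouville X : smooth_on A X ->
  (forall z b c, A z -> hcurv0 S D (X z).1 b c z = 0) ->
  forall z b c, A z -> hcurv0 S D (bracket liouville X z).1 b c z = 0.
Proof.
move=> smX nullX z b c Az.
have e1 : (bracket liouville X z).1 = 'd_(liouville z) (fun y => (X y).1) z.
  rewrite bracketE dirD_liouville /= subr0 (dirD_fst _ smX Az).
  by [].
have fam : linfam A (fun y a => hcurv0 S D a b c y).
  by split=> [y Ay|a]; [exact: (linf_hcurv0 ct b c Ay)|exact: (smooth_hcurv0 ct a b c)].
pose proof (dirD_linfam oA fam (smooth_fst oA smX) (liouville z) Az) as e2.
have e3 : 'd_(liouville z) (fun y => hcurv0 S D (X y).1 b c y) z = 0.
  by rewrite (dirD_ext (g := fun _ => 0) _ oA Az (fun y Ay => nullX y b c Ay)) dirD_cst.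
have e4 : 'd_(liouville z) (fun y => hcurv0 S D (X z).1 b c y) z = 0.
  exact: etrans (homog_hcurv0 ct (X z).1 b c Az) (scale0r _).
have drop (u v w : TV R n) : w = u + v -> w = 0 -> u = 0 -> v = 0.
  by move=> -> + u0; rewrite u0 add0r.
exact: (etrans (congr1 (fun a => hcurv0 S D a b c z) e1) (drop _ _ _ e2 e3 e4)).
Qed.

(** The Liouville field commutes with horizontal lifts of constant vectors. *)
Lemma bracket_liouville_hor X : smooth_on A X ->
  (forall z, A z -> X z = hl z (X z).1) ->
  forall z, A z -> bracket liouville X z = hl z (bracket liouville X z).1.
Proof.
move=> smX horX z Az.
have smX1 := smooth_fst oA smX.
pose proof (dirD_linfam oA (linfam_hlift fS) smX1 (liouville z) Az) as e.
have e1 : bracket liouville X z = hl z ('d_(liouville z) (fun y => (X y).1) z).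
  rewrite bracketE dirD_liouville (dirD_ext _ oA Az horX) e.
  rewrite (dirD_hlift fS _ _ Az) (homog_nlc fS _ Az) scale1r (horX z Az) /=.
  by rewrite addrAC subrr add0r.
by rewrite e1.
Qed.

End Nullity.

(** * Changes of charts *)

Section ChartChange.
Context {R : realType} {n : nat} (M : manifold R n).
Implicit Types (i j : chart M).

Definition overlap i j : set 'rV[R]_n :=
  [set x | (Defs.coord i @` dom i) x /\ dom j (icoord i x)].

Lemma open_overlap i j : open (overlap i j).
Proof.
rewrite openE => x [ix jx].
have n1 : nbhs x (Defs.coord i @` dom i).
  by apply: open_nbhs_nbhs; split => //; exact: image_open.
have n2 : nbhs x (icoord i @^-1` dom j).
  by apply: (icoord_cont ix); apply: open_nbhs_nbhs; split => //; exact: dom_open.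
exact: filterI n1 n2.
Qed.

Lemma open_tover i j : open (tover i j).
Proof.
have -> : tover i j = fst @^-1` overlap i j by [].
by apply: open_comp => [z _|]; [exact: cvg_fst|exact: open_overlap].
Qed.

Lemma open_slit i : open (slit i).
Proof.
have -> : slit i = fst @^-1` (Defs.coord i @` dom i) `&` snd @^-1` (~` [set 0]).
  apply/seteqP; split=> z [tz z0]; split=> //; first by move=> /= e; rewrite e eqxx in z0.
  by apply/eqP.
apply: openI; apply: open_comp.
- by move=> z _; exact: cvg_fst.
- exact: image_open.
- by move=> z _; exact: cvg_snd.
rewrite openC; apply: accessible_closed_set1; apply: hausdorff_accessible.
exact: norm_hausdorff.
Qed.

Local Notation trans i j := (Defs.coord j \o icoord i).

Lemma smooth_trans i j : smooth_on (overlap i j) (trans i j).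
Proof. exact: transition_smooth. Qed.

Lemma linfam_trans i j :
  linfam (tover i j) (fun z v => 'd_v (trans i j) z.1).
Proof.
split=> [z tz|v].
  exact (dirD_linf (@open_overlap i j) (@smooth_trans i j) tz).
apply: (smooth_comp_linf (L := fst) (f := 'd_v (trans i j)) (@linf_fst _ _ _)
  (@continuous_fst _ _ _) (@open_overlap i j)).
exact: smooth_dirD (@smooth_trans i j).
Qed.

Lemma smooth_snd_map (A : set (TV R n)) : smooth_on A (@snd 'rV[R]_n 'rV[R]_n).
Proof. by apply: smooth_linf_map; [exact: linf_snd|exact: continuous_snd]. Qed.

Lemma ttransE i j : ttrans i j = fun z => (trans i j z.1, 'd_(z.2) (trans i j) z.1).
Proof. by apply: funext => z; rewrite dirDE. Qed.

Lemma smooth_ttrans i j : smooth_on (tover i j) (ttrans i j).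
Proof.
rewrite ttransE; apply: (smooth_pair (@open_tover i j)).
  exact: (smooth_comp_linf (L := fst) (@linf_fst _ _ _)
    (@continuous_fst _ _ _) (@open_overlap i j) (@smooth_trans i j)).
exact: (smooth_linfam (@open_tover i j) (linfam_trans i j) (@smooth_snd_map _)).
Qed.

Lemma overlap_trans i j x : overlap i j x -> overlap j i (trans i j x).
Proof.
move=> [[p ip <-] jp]; split; first by exists (icoord i (Defs.coord i p)).
by rewrite /= (coordK jp) (coordK ip).
Qed.

Lemma transK i j x : overlap i j x -> trans j i (trans i j x) = x.
Proof. by move=> [[p ip <-] jp]; rewrite /= (coordK jp) (coordK ip). Qed.

(** The differential of a transition map is injective, since the chain rule
    applies to the inverse transition. *)
Lemma slit_ttrans i j z : slit i z -> tover i j z -> slit j (ttrans i j z).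
Proof.
move=> [tz z0] oz; split; first by have [] := @overlap_trans i j _ oz.
rewrite ttransE /=; apply: contra_neq z0 => e.
have eid : 'd_(z.2) (trans j i \o trans i j) z.1 = z.2.
  rewrite (dirD_ext (g := id) _ (@open_overlap i j) oz (@transK i j)).
  by rewrite (dirD_linf_map _ _ (@linf_id _ _) (fun x => @cvg_id _ (nbhs x))).
pose proof (dirD_chain z.2 (@open_overlap j i) (@smooth_trans i j) (@smooth_trans j i)
  oz (overlap_trans oz)) as ec.
by rewrite -eid ec e dirD0.
Qed.

Lemma pushE i j z a : push i j z a = 'd_a (ttrans i j) z.
Proof. by rewrite dirDE. Qed.

(** The second derivatives of the transition map cancel by symmetry. *)
Lemma related_bracket i j (X Y X' Y' : vf R n) :
  local_vf i X -> local_vf i Y -> local_vf j X' -> local_vf j Y' ->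
  related i j X X' -> related i j Y Y' ->
  related i j (bracket X Y) (bracket X' Y').
Proof.
move=> smX smY smX' smY' rX rY z sz oz.
have oB : open (slit i `&` tover i j).
  by apply: openI; [exact: open_slit|exact: open_tover].
have Bz : (slit i `&` tover i j) z by [].
have smt : smooth_on (slit i `&` tover i j) (ttrans i j).
  by apply: sub_smooth (@smooth_ttrans i j) => y [].
have subB (V : vf R n) : local_vf i V -> smooth_on (slit i `&` tover i j) V.
  by move=> smV; apply: sub_smooth smV => y [].
have step (V W V' W' : vf R n) : local_vf i V -> local_vf i W -> local_vf j W' ->
    related i j V V' -> related i j W W' ->
    'd_(V' (ttrans i j z)) W' (ttrans i j z)
    = 'd_(V z) (fun y => 'd_(W z) (ttrans i j) y) z
      + 'd_('d_(V z) W z) (ttrans i j) z.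
  move=> smV smW smW' rV rW.
  have e2 : 'd_(V z) (W' \o ttrans i j) z
      = 'd_(V z) (fun y => 'd_(W y) (ttrans i j) y) z.
    by apply: (dirD_ext _ oB Bz) => y [sy oy]; rewrite /= (rW y sy oy) pushE.
  pose proof (dirD_chain (V z) (@open_slit j) smt smW' Bz (slit_ttrans sz oz)) as e1.
  pose proof (dirD_dirD_along oB smt (subB W smW) (V z) Bz) as e3.
  rewrite (rV z sz oz) pushE.
  exact: etrans (esym e1) (etrans e2 e3).
rewrite pushE !bracketE.
have lt : is_linear (fun v => 'd_v (ttrans i j) z) by exact (dirD_linf oB smt Bz).
rewrite (linfB lt) (step X Y X' Y')// (step Y X Y' X')//.
rewrite (dirD_schwarz oB (X z) (Y z) smt Bz).
by rewrite opprD addrACA subrr add0r.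
Qed.

(** The induced transition map is linear in the fibre variable. *)
Lemma related_liouville i j : related i j liouville liouville.
Proof.
move=> z sz oz; rewrite pushE ttransE.
have oo := @open_tover i j.
have s1 : smooth_on (tover i j) (fun z => trans i j z.1).
  exact: (smooth_comp_linf (L := fst) (@linf_fst _ _ _)
    (@continuous_fst _ _ _) (@open_overlap i j) (@smooth_trans i j)).
have s2 : smooth_on (tover i j) (fun z => 'd_(z.2) (trans i j) z.1).
  exact: (smooth_linfam oo (linfam_trans i j) (@smooth_snd_map _)).
have base (g : 'rV[R]_n -> 'rV[R]_n) : smooth_on (overlap i j) g ->
    'd_(liouville z) (fun y => g y.1) z = 0.
  move=> smg; rewrite dirDE.
  have dg : derivable g (@fst 'rV[R]_n 'rV[R]_n z) (@fst 'rV[R]_n 'rV[R]_n (liouville z)).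
    exact: derivable0.
  by have [_ ->] := is_derive_comp_linf (@linf_fst R _ _) dg; rewrite derive0.
rewrite (dirD_pair oo _ s1 s2 oz) (base _ (@smooth_trans i j)).
pose proof (dirD_linfam oo (linfam_trans i j) (@smooth_snd_map _) (liouville z) oz) as e.
rewrite e (base _ (smooth_dirD z.2 (@smooth_trans i j))) add0r.
rewrite (dirD_linf_map _ _ (@linf_snd R _ _) (@continuous_snd R _ _)).
by [].
Qed.

Lemma smooth_liouville_slit i : local_vf i (@liouville R n).
Proof. exact: smooth_liouville. Qed.

Lemma vfield_bracket_liouville X : vfield X ->
  vfield (fun i => bracket liouville (X i) : vf R n).
Proof.
move=> [smX rX]; split=> [i|i j].
  exact: (smooth_bracket (@open_slit i) (@smooth_liouville_slit i) (smX i)).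
apply: related_bracket => //; try exact: smooth_liouville_slit.
exact: related_liouville.
Qed.

Lemma vfield0 : vfield (fun (_ : chart M) (_ : TV R n) => 0).
Proof.
split=> [i|i j z _ _]; first exact: smooth_cst.
by rewrite pushE dirD0.
Qed.

End ChartChange.

(** * Nullity distributions *)

Section Localize.
Context {R : realType} {n : nat} {M : manifold R n}.
Implicit Types (i j : chart M).

Lemma semibasic_slit (T : chart M -> TV R n -> TV R n -> TV R n -> TV R n) i :
  symmetric_semibasic T -> semibasic (slit i) (T i).
Proof.
move=> [[bilT smT _] symT JT vT]; split.
- by move=> z a sz c u v; have [_ ->] := bilT i z sz c u v a.
- exact: smT i.
- exact: symT i.
- exact: JT i.
by move=> z a b sz; have := congr1 snd (vT i z a b sz).
Qed.

Lemma cartan_slit (E : chart M -> sf R n) (S : chart M -> vf R n)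
    (F : chart M -> TV R n -> TV R n -> TV R n)
    (C C' : chart M -> TV R n -> TV R n -> TV R n -> TV R n)
    (D0 D : chart M -> vf R n -> endo R n) i :
  finsler E -> canonical_spray E S -> almost_complex S F ->
  first_cartan_tensor E F C -> second_cartan_tensor E S F C' ->
  berwald_connection S F D0 -> cartan_connection S F C C' D0 D ->
  cartan_on (slit i) (E i) (S i) (F i) (C i) (C' i) (D i).
Proof.
move=> [_ [_ _ smE homE rankE]] [[smS _] eqS] [[linF smF _] eqF] [sC eqC] [sC' eqC'].
move=> [_ vert0E hor0E _] [[smD linD leibD _] vertE horE _].
split.
- split.
  + exact: open_slit.
  + by have [] := smE i.
  + exact: smS.
  + by move=> z [tz z0]; have := homE i z tz; rewrite lie0E.
  + exact: rankE i.
  + exact: eqS i.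
- split.
  + by split=> [z sz c a b|a]; [exact: linF|exact: smF].
  + by move=> X smX z sz; have [-> _] := eqF i X smX z sz.
- exact: semibasic_slit.
- exact: semibasic_slit.
- exact: eqC i.
- exact: eqC' i.
- by split; [exact: smD|exact: linD|exact: leibD].
- by move=> X Y smX smY z sz; rewrite (vertE i X Y smX smY z sz) vert0E.
by move=> X Y smX smY z sz; rewrite (horE i X Y smX smY z sz) hor0E.
Qed.

End Localize.

Theorem proposition4p4 (R : realType) (n : nat) (M : manifold R n)
    (E : chart M -> sf R n) (S : chart M -> vf R n)
    (F : chart M -> TV R n -> TV R n -> TV R n)
    (C C' : chart M -> TV R n -> TV R n -> TV R n -> TV R n)
    (D0 D : chart M -> vf R n -> endo R n)
    (finslerE : finsler E)
    (sprayS : canonical_spray E S)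
    (complexF : almost_complex S F)
    (cartanC : first_cartan_tensor E F C)
    (cartanC' : second_cartan_tensor E S F C')
    (berwaldD0 : berwald_connection S F D0)
    (cartanD : cartan_connection S F C C' D0 D) :
  (* (a) *)
  ((exists X, sections (nullity_R S D) X) /\
   (forall (i : chart M) z, slit i z -> nullity_R S D i z !=set0)) /\
  (* (b) *)
  (forall (i : chart M) z, slit i z ->
     nullity_R S D i z `<=` nullity_barthel S i z) /\
  (* (c) *)
  (forall Z, sections (nullity_R S D) Z ->
     forall X Y : chart M -> vf R n, vfield X -> vfield Y ->
     forall (i : chart M) z, slit i z ->
       hcurv (S i) (D i) (X i) (Y i) (Z i) z
       = app2 (C i) (app1 (F i) (barthel_curv (S i) (X i) (Y i))) (Z i) z) /\
  (* (d) *)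
  (sections (nullity_R S D) S ->
     forall (i : chart M) X Y, local_vf i X -> local_vf i Y ->
     forall z, slit i z -> barthel_curv (S i) X Y z = 0) /\
  (* (e) *)
  (forall X, sections (nullity_R S D) X ->
     sections (nullity_R S D) (fun i => bracket liouville (X i)) /\
     sections (nullity_barthel S) (fun i => bracket liouville (X i))).
Proof.
have ct i := cartan_slit i finslerE sprayS complexF cartanC cartanC' berwaldD0 cartanD.
have fS i := ct_spray (ct i).
have smS i : local_vf i (S i) := fs_spray (fS i).
have null_at i z : slit i z -> nullity_R S D i z 0.
  move=> sz; split.
    exists (fun _ => 0); first exact: smooth_cst.
    by rewrite (hprojE (fS i) (smooth_cst _ 0) sz) (linf0 (linf_hlift (fS i) sz)).
  move=> X Y Z smX smY smZ X0; rewrite (hcurvE (ct i) smX smY smZ sz) X0.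
  exact: linf0 (linf_hcurv0 (ct i) _ _ sz).
have null_sub i z : slit i z -> nullity_R S D i z `<=` nullity_barthel S i z.
  move=> sz a [ha nulla]; split=> // X Y smX smY Xa.
  by rewrite -(hcurv_spray (ct i) smX smY sz) nulla.
have null_curv Z : sections (nullity_R S D) Z -> forall i X Y, local_vf i X ->
    local_vf i Y -> forall z, slit i z -> hcurv (S i) (D i) X Y (Z i) z
      = C i z (F i z (barthel_curv (S i) X Y z)) (Z i z).
  move=> [[smZ _] nullZ] i X Y smX smY z sz.
  apply: (hcurv_null (ct i) smX smY (smZ i) sz) => U V smU smV.
  by have [_ nz] := nullZ i z sz; rewrite (nz (Z i) U V (smZ i) smU smV).
split; first split.
- exists (fun _ _ => 0); split; [exact: vfield0|exact: null_at].
- by move=> i z sz; exists 0; exact: null_at.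
split; first exact: null_sub.
split; first by move=> Z nZ X Y [smX _] [smY _] i z sz; exact: (null_curv Z nZ i).
split.
  move=> nS i X Y smX smY z sz; rewrite -(hcurv_spray (ct i) smX smY sz).
  rewrite (null_curv S nS i X Y smX smY z sz).
  exact: (first_cartan_liouville (fS i) (ct_complex (ct i)) (ct_first (ct i))
    (ct_first_eq (ct i)) _ sz (spray_base (fS i) sz)).
move=> X [vX nX]; have smX i : local_vf i (X i) by case: vX.
have horX i z : slit i z -> X i z = hlift (S i) z (X i z).1.
  move=> sz; have [[V smV <-] _] := nX i z sz.
  by rewrite (hprojE (fS i) smV sz).
have nullX i z b c : slit i z -> hcurv0 (S i) (D i) (X i z).1 b c z = 0.
  move=> sz; have [_ nz] := nX i z sz.
  rewrite -[LHS](hcurvE (ct i) (smX i) (smooth_cst _ (hor b)) (smooth_cst _ (hor c)) sz).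
  by apply: nz => //; [exact: smooth_cst|exact: smooth_cst].
have vB := vfield_bracket_liouville vX.
have nB i z : slit i z -> nullity_R S D i z (bracket liouville (X i) z).
  move=> sz; have smB : local_vf i (bracket liouville (X i)) by case: vB.
  split.
    exists (bracket liouville (X i)) => //.
    rewrite (hprojE (fS i) smB sz).
    exact: esym (bracket_liouville_hor (ct i) (smX i) (fun z => horX i z) sz).
  move=> V Y Z smV smY smZ eV; rewrite (hcurvE (ct i) smV smY smZ sz) eV.
  by rewrite (null_bracket_liouville (ct i) (smX i) (nullX i)).
split; split; [exact: vB|exact: nB|exact: vB|] => i z sz.
exact: (null_sub i z sz _ (nB i z sz)).
Qed.
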